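(* Consider the random sequential adsorption process with nearest-neighbor exclusion on the one-dimensional lattice $\mathbb{Z}$, and let $C_s(t)=\mathbb{E}[\omega_0(t)\omega_s(t)]-\mathbb{E}[\omega_0(t)]\,\mathbb{E}[\omega_s(t)]$. For all $t\in[0,1]$ and all integers $s\ge 0$, $$C_s(t)=-\tfrac{1}{2}e^{-2t}\sum_{n=0}^{\infty}\frac{(-2t)^{2n+s+1}}{(2n+s+1)!}.$$
   Context: Let $T=(t_s)_{s\in\mathbb{Z}}$ be a family of i.i.d. random variables uniformly distributed on $[0,1]$, with product law $\mathbb{P}$ on $[0,1]^{\mathbb{Z}}$ and expectation $\mathbb{E}$. The random sequential adsorption (RSA) process with nearest-neighbor exclusion on $\mathbb{Z}$ is defined as follows. At time $0$ all sites are vacant; at time $t_s$ the site $s$ becomes occupied (and stays occupied forever) if and only if both $s-1$ and $s+1$ are vacant at time $t_s$; there is no other attempt to occupy $s$. Write $\omega_s(t)=\omega_s(T,t)\in\{0,1\}$ for the state of site $s$ at time $t\in[0,1]$ ($1$ = occupied, $0$ = vacant). Thus $\omega_s(t)=1$ if and only if $t_s\le t$, $\omega_{s-1}(t_s)=0$ and $\omega_{s+1}(t_s)=0$. For $\mathbb{P}$-almost every $T$ these rules determine $\omega_s(t)$ uniquely for all $s\in\mathbb{Z}$ and $t\in[0,1]$. The pair correlation of sites $i,j\in\mathbb{Z}$ at time $t$ is the covariance $\mathbb{E}[\omega_i(t)\omega_j(t)]-\mathbb{E}[\omega_i(t)]\,\mathbb{E}[\omega_j(t)]$; by translation invariance it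 depends only on $s=|i-j|$ and equals $C_s(t)$. *)

(* Defs.v *)
From HB Require Import structures.
From mathcomp Require Import all_boot all_order all_algebra.
From mathcomp Require Import all_classical all_reals all_analysis.

Set Implicit Arguments.
Unset Strict Implicit.
Unset Printing Implicit Defensive.

Import Order.TTheory GRing.Theory Num.Theory.
Import numFieldNormedType.Exports.

Local Open Scope classical_set_scope.
Local Open Scope ring_scope.

Definition mutually_independent (d : measure_display) (Omega : measurableType d)
    (R : realType) (P : probability Omega R) (I : choiceType)
    (X : I -> {RV P >-> R}) : Prop :=
  forall (r : seq I) (A : I -> set R), uniq r ->
    (forall i, measurable (A i)) ->
    P (\bigcap_(i in [set` r]) (X i @^-1` A i)) =
    (\prod_(i <- r) P (X i @^-1` A i))%E.

Definition uniform01 (d : measure_display) (Omega : measurableType d)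
    (R : realType) (P : probability Omega R) (X : {RV P >-> R}) : Prop :=
  forall A : set R, measurable A ->
    distribution P X A = uniform_prob (@ltr01 R) A.

Definition iid_uniform01 (d : measure_display) (Omega : measurableType d)
    (R : realType) (P : probability Omega R) (I : choiceType)
    (X : I -> {RV P >-> R}) : Prop :=
  mutually_independent X /\ (forall i, uniform01 (X i)).

Definition rsa_rules (R : realType) (T : int -> R) (w : int -> R -> bool) : Prop :=
  forall (s : int) (t : R), 0 <= t <= 1 ->
    w s t = [&& T s <= t, ~~ w (s - 1) (T s) & ~~ w (s + 1) (T s)].

(* [rsa_rules T] has exactly one solution on [0, 1] for almost every [T]; on
   the exceptional null set an arbitrary solution is selected if there is one,
   and every site is left vacant otherwise. *)
Definition rsa (R : realType) (T : int -> R) : int -> R -> bool :=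
  xget (fun _ _ => false) [set w | rsa_rules T w].

Definition occ (d : measure_display) (Omega : measurableType d) (R : realType)
    (P : probability Omega R) (tau : int -> {RV P >-> R}) (s : int) (t : R) :
    Omega -> R :=
  fun x => (rsa (fun i => tau i x) s t)%:R.

Definition pair_correlation (d : measure_display) (Omega : measurableType d)
    (R : realType) (P : probability Omega R) (tau : int -> {RV P >-> R})
    (i j : int) (t : R) : \bar R :=
  ('E_P[(occ tau i t \* occ tau j t)%R] -
   'E_P[occ tau i t] * 'E_P[occ tau j t])%E.

(* Main.v *)
Require Import Defs.
From HB Require Import structures.
From mathcomp Require Import all_boot all_order all_algebra.
From mathcomp Require Import all_classical all_reals all_analysis.
From mathcomp Require Import measurable_realfun zify ring lra.

(** The argument is combinatorial once the dynamics is made explicit. Write T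
    for the family of arrival times. Almost surely all times lie in [0, 1],
    neighbouring times differ and decreasing runs of times are finite. In such
    a configuration follow the times from s to the right as long as they
    decrease: the last site of this run is a local minimum on that side, so it
    gets occupied, the one before it is then blocked, the one before that gets
    occupied, and so on. Hence s + 1 is vacant at time T s if and only if the
    right run of s has even length, and similarly on the left: s is occupied at
    time t if and only if T s <= t and both runs of s are even ([rsaE]).

    Call a site occupied from the left if its time is at most t and its left
    run is even, and let A k be the probability that 0 is occupied from the
    left and T 0 > ... > T k ([occ_run]). The one analytic ingredient is that
    k + 1 given times are all at most t and in a given order with probability
    t^(k+1)/(k+1)! ([prob_chain]). Comparing the two times across the edge
    between two independent half-lines gives
    A 0 * t^(k+1)/(k+1)! = t^(k+1)/(k+1)! - A k + A (k+1) ([occ_run_rec]), and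
    since A k tends to 0 this forces A k = 1 - e^-t (sum_(j <= k) t^j/j!)
    ([occ_runE]).

    Let Q s be the probability that 0 and s are both occupied at time t. The
    indicator of an even run is the alternating sum over k of the indicators
    that the run has length at least k. Doing this for the right run of 0 and
    for the left run of s writes Q s as a double alternating sum over pairs
    (k, l) with k + l <= s ([pair_occ_expansion]). If k + l < s the two runs do
    not meet and the term is A k * A l. If k + l = s they meet in a valley at
    site k. The valleys with minimum at k and at k + 1 split the event that the
    times decrease from 0 to k and increase from k + 1 to s, according to the
    order of the two middle times, so their probabilities add up to a product
    of two values of A ([valley_split]); reflection and the relation
    [valley_start] for the degenerate valley with minimum at 0 determine the
    total. What remains are
    discrete convolutions of exponential sums, and they collapse to
    Q (s+1) - Q s = (-1)^(s+1)/2 * (1 - e^(-2t) * sum_(m <= s) (2t)^m/m!)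
    ([pair_occ_step]). The series of the statement consists of the terms of
    one parity in a tail of the exponential series, so it has the closed form
    [limn_parity_series], with the same initial value and the same increments.

    Independence is only postulated for measurable boxes. It is transferred to
    events that depend on infinitely many times by uniqueness of measures on
    path space ([iid_law], [prob_indep]); this also gives the invariance of all
    probabilities under translations and reflections. On a null set the
    occupation variable is arbitrary and perhaps not measurable; its integral is
    squeezed between those of two indicators of the same measure
    ([expectation_ae_indicator]). *)

Set Implicit Arguments.
Unset Strict Implicit.
Unset Printing Implicit Defensive.

Import Order.TTheory GRing.Theory Num.Theory.
Import numFieldNormedType.Exports.

Local Open Scope classical_set_scope.
Local Open Scope ring_scope.

(** * Path space and its events *)
Definition cylinders (R : realType) (I : choiceType) : set (set (I -> R)) :=
  [set E | exists (r : seq I) (A : I -> set R),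
     [/\ uniq r, forall i, measurable (A i) &
         E = [set x | forall i, i \in r -> A i (x i)]]].

Definition path_space (R : realType) (I : choiceType) :=
  g_sigma_algebraType (@cylinders R I).

HB.instance Definition _ (R : realType) (I : choiceType) :=
  Measurable.on (path_space R I).

Section Paths.
Variables (R : realType) (I : choiceType).

Lemma setI_closed_cylinders : setI_closed (@cylinders R I).
Proof.
move=> _ _ [r [A [ur mA ->]]] [s [B [us mB ->]]].
exists (undup (r ++ s)).
exists (fun i => (if i \in r then A i else setT) `&`
                 (if i \in s then B i else setT)).
split; first exact: undup_uniq.
  by move=> i; apply: measurableI; case: ifP.
apply/seteqP; split => x /=.
  move=> [xr xs] i _; split.
    by case: ifP => // /xr.
  by case: ifP => // /xs.
move=> h; split => i ir.
  by have [] := h i; rewrite ?mem_undup ?mem_cat ?ir.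
by have [] := h i; rewrite ?mem_undup ?mem_cat ?ir ?orbT.
Qed.

Lemma measurable_coord (i : I) :
  measurable_fun setT (fun x : path_space R I => x i).
Proof.
move=> _ A mA; rewrite setTI; apply: sub_sigma_algebra.
exists [:: i], (fun=> A); split => //.
apply/seteqP; split => x /=; first by move=> Ax j; rewrite inE => /eqP ->.
by apply; rewrite inE.
Qed.

(** Cylinders are stable under intersection and generate the measurable
    sets, so a finite measure on path space is determined by them. *)
Lemma measure_unique_cylinders (m1 m2 : {measure set (path_space R I) -> \bar R}) :
    (m1 setT < +oo)%E -> (forall E, cylinders E -> m1 E = m2 E) ->
  forall E, measurable E -> m1 E = m2 E.
Proof.
move=> m1oo m12 E mE.
apply: (@measure_unique _ R (path_space R I) (@cylinders R I) (fun=> setT) _ _ _ _ m1 m2) => //.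
- exact: setI_closed_cylinders.
- move=> _; exists [::], (fun=> setT); split => //.
  by apply/seteqP; split.
- by rewrite bigcup_const.
Qed.

Lemma measurable_path d (Omega : measurableType d) (X : I -> Omega -> R) :
  (forall i, measurable_fun setT (X i)) ->
  measurable_fun setT (fun w => (fun i => X i w) : path_space R I).
Proof.
move=> mX.
apply: (@measurability _ _ Omega (path_space R I) setT _ (@cylinders R I)) => //.
move=> _ [_ [r [A [ur mA ->]]] <-].
rewrite setTI.
rewrite (_ : _ @^-1` _ = \bigcap_(i in [set` r]) (X i @^-1` A i)); last first.
  by apply/seteqP; split.
apply: fin_bigcap_measurable => // i _.
by rewrite -[X in measurable X]setTI; exact: mX.
Qed.

Lemma measurable_reindex (J : choiceType) (f : J -> I) :
  measurable_fun setT (fun x : path_space R I => (fun j => x (f j)) : path_space R J).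
Proof.
apply: (@measurability _ _ (path_space R I) (path_space R J) setT _ (@cylinders R J)) => //.
move=> _ [_ [r [A [ur mA ->]]] <-].
rewrite setTI.
rewrite (_ : _ @^-1` _ =
  \bigcap_(i in [set` r]) ((fun x : path_space R I => x (f i)) @^-1` A i)); last first.
  by apply/seteqP; split.
apply: fin_bigcap_measurable => // i _.
by rewrite -[X in measurable X]setTI; apply: measurable_coord.
Qed.
End Paths.

(** Events are boolean functions of the family of times, so that conjunctions
    and negations of events reduce by computation. *)
Definition is_event (R : realType) (I : choiceType) (phi : (I -> R) -> bool) :=
  measurable_fun [set: path_space R I] phi.

(** * Laws of independent uniform families *)
Section Law.
Context d (Omega : measurableType d) (R : realType) (P : probability Omega R).

(** Probabilities as real numbers. On events the measure is finite
    ([probE]), so nothing is lost. *)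
Definition prob (I : choiceType) (X : I -> {RV P >-> R})
    (phi : (I -> R) -> bool) : R :=
  fine (P [set w | phi (fun i => X i w)]).

Section OneFamily.
Variables (I : choiceType) (X : I -> {RV P >-> R}).
Implicit Types phi psi : (I -> R) -> bool.

Lemma measurable_event phi : is_event phi ->
  measurable [set w | phi (fun i => X i w)].
Proof.
move=> mphi.
rewrite (_ : mkset _ = (fun w => (fun i => X i w) : path_space R I) @^-1`
   (phi @^-1` [set true])); last by apply/seteqP; split.
rewrite -[X in measurable X]setTI; apply: measurable_path => //.
by rewrite -[X in measurable X]setTI; exact: mphi.
Qed.

Lemma probE phi : is_event phi -> P [set w | phi (fun i => X i w)] = (prob X phi)%:E.
Proof.
by move=> mphi; rewrite /prob fineK// fin_num_measure//; exact: measurable_event.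
Qed.

Lemma prob_ge0 phi : 0 <= prob X phi.
Proof. exact: fine_ge0. Qed.

Lemma prob_le phi psi : is_event phi -> is_event psi -> (forall x, phi x -> psi x) ->
  prob X phi <= prob X psi.
Proof.
move=> mphi mpsi h; rewrite -lee_fin -!probE// le_measure ?inE//.
- exact: measurable_event.
- exact: measurable_event.
- by move=> w /h.
Qed.

Lemma prob_split phi psi : is_event phi -> is_event psi ->
  prob X phi = prob X (fun x => phi x && psi x) + prob X (fun x => phi x && ~~ psi x).
Proof.
move=> mphi mpsi; apply: EFin_inj; rewrite EFinD -!probE//; last 2 first.
- exact/measurable_and/measurable_neg.
- exact: measurable_and.
rewrite -measureU.
- congr (P _); apply/seteqP; split => w /=.
    by case: (psi _) => ->; [left|right].
  by move=> [] /andP[].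
- by apply: (@measurable_event (fun x => phi x && psi x)); exact: measurable_and.
- apply: (@measurable_event (fun x => phi x && ~~ psi x)).
  exact/measurable_and/measurable_neg.
- apply/seteqP; split => w //= -[] /andP[_ ->]. by rewrite andbF.
Qed.

Lemma prob_true : prob X (fun=> true) = 1.
Proof.
by rewrite /prob (_ : mkset _ = setT) ?probability_setT//; apply/seteqP.
Qed.

Lemma prob_neg phi : is_event phi -> prob X (fun x => ~~ phi x) = 1 - prob X phi.
Proof.
move=> mphi; rewrite -prob_true (prob_split (phi := fun=> true) _ mphi) /=.
  by rewrite addrC addKr.
exact: measurable_cst.
Qed.

Lemma prob_ae good phi psi : is_event good -> is_event phi -> is_event psi ->
    prob X good = 1 -> (forall x, good x -> phi x = psi x) ->
  prob X phi = prob X psi.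
Proof.
move=> mg mphi mpsi g1 h.
have z chi : is_event chi -> prob X (fun x => chi x && ~~ good x) = 0.
  move=> mchi; apply/eqP; rewrite eq_le prob_ge0 andbT.
  rewrite -[leRHS](subrr 1) -{2}g1 -prob_neg//.
  apply: prob_le; [exact/measurable_and/measurable_neg|exact/measurable_neg|].
  by move=> x /andP[].
rewrite (prob_split mphi mg) (prob_split mpsi mg) !z// !addr0.
by congr prob; apply/funext => x; case: (boolP (good x)) => gx; rewrite ?andbT ?andbF ?h.
Qed.

End OneFamily.

Section Independence.

(** A box constraint on X (f j) is moved to the index f j; the indices
    outside the range of f receive the constraint that holds everywhere, which
    is what B does. *)
Lemma iid_comp (I J : choiceType) (X : I -> {RV P >-> R}) (f : J -> I) :
  injective f -> iid_uniform01 X -> iid_uniform01 (X \o f).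
Proof.
move=> inj_f [iX uX]; split => [r A ur mA|i]; last exact: uX.
pose B i := [set y | forall j, f j = i -> A j y].
have Bf j : B (f j) = A j.
  apply/seteqP; split => y; first by apply.
  by move=> Ay k /inj_f ->.
have mB i : measurable (B i).
  have [[j <-]|n] := pselect (exists j, f j = i); first by rewrite Bf.
  rewrite (_ : B i = setT) //; apply/seteqP; split => // y _ j fj.
  by exfalso; apply: n; exists j.
have := iX (map f r) B; rewrite map_inj_uniq// => /(_ ur mB).
rewrite big_map; under eq_bigr do rewrite Bf; move=> <-.
congr (P _); apply/seteqP; split => w /=.
  by move=> h _ /= /mapP[j jr ->]; rewrite Bf; exact: h.
by move=> h j /= jr; have /= := h (f j) (map_f f jr); rewrite Bf.
Qed.

Lemma prob_cylinder (I : choiceType) (X : I -> {RV P >-> R}) r A :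
    mutually_independent X -> uniq r -> (forall i, measurable (A i)) ->
  P [set w | forall i, i \in r -> A i (X i w)] =
  (\prod_(i <- r) P (X i @^-1` A i))%E.
Proof.
by move=> iX ur mA; rewrite -iX//; congr (P _); apply/seteqP; split.
Qed.

(** Both laws give every cylinder the same product of uniform
    probabilities. *)
Lemma iid_law (I : choiceType) (X Y : I -> {RV P >-> R}) phi :
  iid_uniform01 X -> iid_uniform01 Y -> is_event phi -> prob X phi = prob Y phi.
Proof.
move=> [iX uX] [iY uY] mphi; rewrite /prob; congr fine.
have mX := measurable_path (fun i => @measurable_funPT _ _ _ _ (X i)).
have mY := measurable_path (fun i => @measurable_funPT _ _ _ _ (Y i)).
have mp : measurable ((phi : path_space R I -> bool) @^-1` [set true]).
  by rewrite -[X in measurable X]setTI; exact: mphi.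
pose X' : {mfun Omega >-> path_space R I} := mfun_Sub (mem_set mX).
pose Y' : {mfun Omega >-> path_space R I} := mfun_Sub (mem_set mY).
apply: (@measure_unique_cylinders R I (distribution P X')
  (distribution P Y') _ _ _ mp) => /=.
  by rewrite probability_setT ltry.
move=> _ [r [A [ur mA ->]]].
transitivity (P [set w | forall i, i \in r -> A i (X i w)]) => //.
rewrite prob_cylinder//.
transitivity (P [set w | forall i, i \in r -> A i (Y i w)]) => //.
rewrite prob_cylinder//; apply: eq_bigr => i _.
by have := uX i _ (mA i); rewrite -(uY i _ (mA i)).
Qed.

End Independence.
End Law.

Section Indep.
Context d (Omega : measurableType d) (R : realType) (P : probability Omega R).

Lemma measurable_in_path (I : choiceType) (Y : I -> {RV P >-> R})
    (E : set (path_space R I)) : measurable E ->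
  measurable [set w | E (fun i => Y i w)].
Proof.
move=> mE; rewrite -[X in measurable X]setTI.
exact: (measurable_path (fun i => @measurable_funPT _ _ _ _ (Y i))).
Qed.

(** For a fixed B, both sides are finite measures in E. *)
Lemma indep_of_cylinders (I : choiceType) (Y : I -> {RV P >-> R})
    (B : set Omega) : measurable B ->
    (forall E, cylinders E ->
      P ([set w | E (fun i => Y i w)] `&` B) =
      (P B * P [set w | E (fun i => Y i w)])%E) ->
  forall E : set (path_space R I), measurable E ->
    P ([set w | E (fun i => Y i w)] `&` B) =
    (P B * P [set w | E (fun i => Y i w)])%E.
Proof.
move=> mB h E mE.
have mY := measurable_path (fun i => @measurable_funPT _ _ _ _ (Y i)).
pose Y' : {mfun Omega >-> path_space R I} := mfun_Sub (mem_set mY).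
have PB : (0 <= fine (P B)) by apply: fine_ge0.
pose c : {nonneg R} := NngNum PB.
have cE : c%:num%:E = P B by rewrite /= fineK// fin_num_measure.
rewrite -cE.
apply: (@measure_unique_cylinders R I (pushforward (mrestr P mB) Y')
  (mscale c (distribution P Y')) _ _ _ mE) => /=.
  rewrite /pushforward /mrestr.
  by rewrite ltey_eq fin_num_measure//; apply: measurableI => //; exact: measurableT.
move=> F cF; rewrite /pushforward /mrestr /mscale/=.
by have := h F cF; rewrite -cE.
Qed.

(** Two disjoint blocks of times are independent. The product rule holds
    for two cylinders by mutual independence of the family indexed by the
    disjoint union I + J; it is then extended to arbitrary events one block
    at a time. *)
Lemma prob_indep (I J K : choiceType) (X : K -> {RV P >-> R}) (f : I -> K)
    (g : J -> K) phi psi :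
    iid_uniform01 X -> injective f -> injective g ->
    (forall i j, f i != g j) -> is_event phi -> is_event psi ->
  prob X (fun x => phi (fun i => x (f i)) && psi (fun j => x (g j))) =
  prob X (fun x => phi (fun i => x (f i))) *
  prob X (fun x => psi (fun j => x (g j))).
Proof.
move=> iX inj_f inj_g fg mphi mpsi.
have [iXf _] := iid_comp inj_f iX.
have [iXg _] := iid_comp inj_g iX.
have inj_h : injective (fun ij : I + J => match ij with inl i => f i | inr j => g j end).
  move=> [i|j] [i'|j'] /=.
  - by move=> /inj_f ->.
  - by move=> /eqP; rewrite (negbTE (fg _ _)).
  - by move=> /esym/eqP; rewrite (negbTE (fg _ _)).
  - by move=> /inj_g ->.
have [iXh _] := iid_comp inj_h iX.
pose EF (E : set (I -> R)) := [set w | E (fun i => (X \o f) i w)].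
pose FF (F : set (J -> R)) := [set w | F (fun j => (X \o g) j w)].
have step0 E F : cylinders E -> cylinders F ->
    P (EF E `&` FF F) = (P (FF F) * P (EF E))%E.
  move=> [r [A [ur mA ->]]] [s [B [us mB ->]]].
  rewrite /EF /FF !prob_cylinder// muleC.
  pose C (ij : I + J) := match ij with inl i => A i | inr j => B j end.
  have := iXh (map inl r ++ map inr s) C.
  rewrite cat_uniq !map_inj_uniq//; last 2 first.
  - by move=> ? ? [].
  - by move=> ? ? [].
  rewrite ur us andbT big_cat !big_map => /=; move=> H.
  rewrite -H//.
  - congr (P _); apply/seteqP; split => w /=.
      move=> [hr hs] [i|j] /=; rewrite mem_cat => /orP[] /mapP[k kr]// [->].
        exact: hr.
      exact: hs.
    move=> h; split => i ir.
      by apply: (h (inl i)); rewrite /= mem_cat map_f.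
    by apply: (h (inr i)); rewrite /= mem_cat map_f ?orbT.
  - by apply/hasPn => _ /mapP[j _ ->]; apply/mapP => -[].
  - by case.
have cylm I' E : cylinders E -> measurable (E : set (path_space R I')).
  by move=> cE; exact: sub_sigma_algebra.
have mE : measurable ((phi : path_space R I -> bool) @^-1` [set true]).
  by rewrite -[X in measurable X]setTI; exact: mphi.
have mF : measurable ((psi : path_space R J -> bool) @^-1` [set true]).
  by rewrite -[X in measurable X]setTI; exact: mpsi.
have step1 E F : measurable (E : set (path_space R I)) -> cylinders F ->
    P (EF E `&` FF F) = (P (FF F) * P (EF E))%E.
  move=> mE' cF; apply: indep_of_cylinders => //.
  - by apply: measurable_in_path; exact: cylm.
  - by move=> E' cE'; exact: step0.
have step2 E F : measurable (E : set (path_space R I)) ->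
    measurable (F : set (path_space R J)) ->
    P (FF F `&` EF E) = (P (EF E) * P (FF F))%E.
  move=> mE' mF'; apply: indep_of_cylinders => //.
  - exact: measurable_in_path.
  - by move=> F' cF'; rewrite setIC step1// muleC.
have := step2 _ _ mE mF; rewrite setIC => H.
rewrite /prob -fineM.
- rewrite -H; congr (fine (P _)); apply/seteqP; split => w /=.
    by move=> /andP[].
  by move=> [? ?]; apply/andP.
- by rewrite fin_num_measure//; exact: (@measurable_in_path _ (X \o f) _ mE).
- by rewrite fin_num_measure//; exact: (@measurable_in_path _ (X \o g) _ mF).
Qed.

Lemma prob_reindex (I K : choiceType) (X : K -> {RV P >-> R}) (f g : I -> K) phi :
  iid_uniform01 X -> injective f -> injective g -> is_event phi ->
  prob X (fun x => phi (fun i => x (f i))) = prob X (fun x => phi (fun i => x (g i))).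
Proof.
move=> iX inj_f inj_g mphi.
exact: (iid_law (iid_comp inj_f iX) (iid_comp inj_g iX) mphi).
Qed.

Lemma prob_coord_le (K : choiceType) (X : K -> {RV P >-> R}) k t :
  iid_uniform01 X -> 0 <= t <= 1 -> prob X (fun x => x k <= t) = t.
Proof.
move=> [_ uX] /andP[t0 t1]; rewrite /prob.
have -> : [set w | X k w <= t] = X k @^-1` `]-oo, t].
  by apply/seteqP; split => w; rewrite /= in_itv.
have := uX k _ (measurable_itv `]-oo, t]); rewrite /distribution /pushforward => ->.
rewrite /uniform_prob integral_uniform_pdf.
rewrite (_ : _ `&` _ = `[0, t]%classic); last first.
  apply/seteqP; split => x /=; rewrite !in_itv/=.
    by move=> [xt /andP[-> _]].
  by move=> /andP[-> xt]; split => //; rewrite (le_trans xt).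
rewrite (eq_integral (fun=> 1%E)).
  rewrite integral_cst//= lebesgue_measure_itv/= lte_fin mul1e.
  by case: ltP => t0'; rewrite -?EFinD/= ?subr0//; apply/eqP; rewrite eq_le t0.
move=> x; rewrite inE/= in_itv/= => /andP[x0 xt].
by rewrite /uniform_pdf x0 (le_trans xt)//= subr0 invr1.
Qed.

Lemma prob_coord_ge0 (K : choiceType) (X : K -> {RV P >-> R}) k :
  iid_uniform01 X -> prob X (fun x => 0 <= x k) = 1.
Proof.
move=> [_ uX]; rewrite /prob.
have -> : [set w | 0 <= X k w] = X k @^-1` `[0, +oo[.
  by apply/seteqP; split => w; rewrite /= in_itv/= andbT.
have := uX k _ (measurable_itv `[0, +oo[); rewrite /distribution /pushforward => ->.
rewrite /uniform_prob integral_uniform_pdf1//= => x /=; rewrite !in_itv/=.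
by move=> /andP[->].
Qed.

End Indep.

(** * Decreasing runs *)
Section Runs.
Variable R : realType.
Implicit Types x y : nat -> R.

Definition run_ge x (k : nat) := [forall i : 'I_k, x i.+1 < x i].

Definition even_run x := `[< exists n, run_ge x n.*2 && ~~ (x n.*2.+1 < x n.*2) >].

Definition finite_run x := `[< exists n, ~~ run_ge x n >].

Lemma run_geP x k : reflect (forall i, (i < k)%N -> x i.+1 < x i) (run_ge x k).
Proof.
apply: (iffP forallP) => [h i ik|h i]; first exact: h (Ordinal ik).
exact: h.
Qed.

Lemma run_ge0 x : run_ge x 0.
Proof. by apply/run_geP. Qed.

Lemma run_geS x k : run_ge x k.+1 = run_ge x k && (x k.+1 < x k).
Proof.
apply/run_geP/andP => [h|[/run_geP h xk] i].
  by split; [apply/run_geP => i ik; apply: h; rewrite ltnS ltnW|exact: h].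
by rewrite ltnS leq_eqVlt => /orP[/eqP ->|]//; exact: h.
Qed.

Lemma run_geSl x k :
  run_ge x k.+1 = (x 1%N < x 0%N) && run_ge (fun n => x n.+1) k.
Proof.
apply/run_geP/andP => [h|[x1 /run_geP h] [|i]//]; last by rewrite ltnS => /h.
by split; [exact: h|apply/run_geP => i ik; exact: h].
Qed.

Lemma eq_run_ge x y k : (forall i, (i <= k)%N -> x i = y i) ->
  run_ge x k = run_ge y k.
Proof.
move=> xy; apply/run_geP/run_geP => h i ik.
  by rewrite -!xy ?h// ltnW.
by rewrite !xy ?h// ltnW.
Qed.

(** Removing the first step of a run changes its parity. A finite run is
    assumed because an infinite one has no parity, and neither has its tail. *)
Lemma even_runE x : finite_run x ->
  even_run x = ~~ ((x 1%N < x 0%N) && even_run (fun n => x n.+1)).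
Proof.
move=> /asboolP[m hm].
case: (boolP (x 1%N < x 0%N)) => x10 /=; last first.
  by apply/asboolP; exists 0%N; rewrite run_ge0.
apply/asboolP/negP => [[n /andP[rn xn]] /asboolP[n' /andP[rn' xn']]|no].
  have rx : run_ge x n'.*2.+1 by rewrite run_geSl x10.
  have [lt|ge] := ltnP n'.*2.+1 n.*2.
    move/negP: xn'; apply.
    by move/run_geP: rn; apply.
  have lt : (n.*2 < n'.*2.+1)%N by lia.
  by move/negP: xn; apply; move/run_geP: rx; apply.
(* k is the exact length of the run. *)
have [k [rk nk]] : exists k, run_ge x k /\ ~~ run_ge x k.+1.
  elim: m hm => [|m IH]; first by rewrite run_ge0.
  by case: (boolP (run_ge x m)) => [rm hm|/IH//]; exists m.
have xk : ~~ (x k.+1 < x k) by move: nk; rewrite run_geS rk.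
exists k./2; move: (odd_double_half k); case: (boolP (odd k)) => [ok|ek] /=.
  rewrite add1n => kE; exfalso; apply: no; apply/asboolP; exists k./2.
  rewrite kE xk andbT.
  by move: rk; rewrite -{1}kE run_geSl x10.
by rewrite add0n => ->; rewrite rk xk.
Qed.

End Runs.

(** * Measurability of events *)
Section Measurability.
Variables (R : realType).

Lemma event_lt (I : choiceType) (i j : I) : is_event (fun x : I -> R => x i < x j).
Proof.
exact: (measurable_fun_ltr (@measurable_coord R I i) (@measurable_coord R I j)).
Qed.

Lemma event_le (I : choiceType) (i : I) (t : R) : is_event (fun x : I -> R => x i <= t).
Proof.
exact: (measurable_fun_ler (@measurable_coord R I i) (measurable_cst _)).
Qed.

Lemma event_ge (I : choiceType) (i : I) (t : R) : is_event (fun x : I -> R => t <= x i).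
Proof.
exact: (measurable_fun_ler (measurable_cst _) (@measurable_coord R I i)).
Qed.

Lemma event_true (I : choiceType) : is_event (fun _ : I -> R => true).
Proof. exact: measurable_cst. Qed.

Lemma event_and (I : choiceType) (phi psi : (I -> R) -> bool) :
  is_event phi -> is_event psi -> is_event (fun x => phi x && psi x).
Proof. exact: measurable_and. Qed.

Lemma event_neg (I : choiceType) (phi : (I -> R) -> bool) :
  is_event phi -> is_event (fun x => ~~ phi x).
Proof. exact: measurable_neg. Qed.

Lemma event_ex (I : choiceType) (phi : nat -> (I -> R) -> bool) :
  (forall n, is_event (phi n)) -> is_event (fun x => `[< exists n, phi n x >]).
Proof.
move=> mphi; rewrite /is_event; apply: (measurable_fun_bool true).
rewrite setTI (_ : _ @^-1` _ = \bigcup_n (phi n @^-1` [set true])).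
  apply: bigcupT_measurable => n.
  by rewrite -[X in measurable X]setTI; exact: mphi.
apply/seteqP; split => x /=.
  by move=> /asboolP[n pn]; exists n.
by move=> [n _ pn]; apply/asboolP; exists n.
Qed.

Lemma event_all (I : choiceType) (phi : nat -> (I -> R) -> bool) :
  (forall n, is_event (phi n)) -> is_event (fun x => `[< forall n, phi n x >]).
Proof.
move=> mphi.
rewrite (_ : (fun _ => _) = fun x => ~~ `[< exists n, ~~ phi n x >]).
  by apply: event_neg; apply: event_ex => n; exact: event_neg.
apply/funext => x; rewrite -asbool_neg; congr asbool.
apply/propext; split=> [h [n]|h n]; first by rewrite h.
by apply: contra_notT h => pn; exists n.
Qed.

Lemma event_reindex (I J : choiceType) (f : J -> I) (phi : (J -> R) -> bool) :
  is_event phi -> is_event (fun x : I -> R => phi (fun j => x (f j))).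
Proof.
move=> mphi; rewrite /is_event.
exact: (measurableT_comp (f := (phi : path_space R J -> bool)) mphi (measurable_reindex f)).
Qed.

Lemma event_run k : is_event (fun x : nat -> R => run_ge x k).
Proof.
elim: k => [|k IH].
  rewrite (_ : (fun _ => _) = fun=> true); first exact: event_true.
  by apply/funext => x; rewrite run_ge0.
rewrite (_ : (fun _ => _) = fun x => run_ge x k && (x k.+1 < x k)).
  by apply: event_and => //; exact: event_lt.
by apply/funext => x; rewrite run_geS.
Qed.

Lemma event_even : is_event (@even_run R).
Proof.
apply: event_ex => n; apply: event_and; first exact: event_run.
by apply: event_neg; exact: event_lt.
Qed.

Lemma event_finite : is_event (@finite_run R).
Proof. by apply: event_ex => n; apply: event_neg; exact: event_run. Qed.

Lemma event_run_comp (I : choiceType) (f : nat -> I) k :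
  is_event (fun x : I -> R => run_ge (fun n => x (f n)) k).
Proof. exact: (event_reindex f (event_run k)). Qed.

Lemma event_even_comp (I : choiceType) (f : nat -> I) :
  is_event (fun x : I -> R => even_run (fun n => x (f n))).
Proof. exact: (event_reindex f event_even). Qed.

Lemma event_finite_comp (I : choiceType) (f : nat -> I) :
  is_event (fun x : I -> R => finite_run (fun n => x (f n))).
Proof. exact: (event_reindex f event_finite). Qed.

End Measurability.

(** Reads off the shape of an event and closes the measurability goal.
    Matching the shape before applying a lemma keeps unification from unfolding
    the events, and the last case can be extended with named events. *)
Ltac event_atom := fail.
Ltac event := cbv beta; lazymatch goal with
  | |- is_event (fun x => @?f x && @?g x) =>
      apply: (@event_and _ _ f g); [event | event]
  | |- is_event (fun x => ~~ @?f x) => apply: (@event_neg _ _ f); event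
  | |- is_event (fun x => x _ < x _) => exact: event_lt
  | |- is_event (fun x => x _ <= _) => exact: event_le
  | |- is_event (fun x => _ <= x _) => exact: event_ge
  | |- is_event (fun x => run_ge (@?f x) _) => exact: event_run_comp
  | |- is_event (fun x => even_run (@?f x)) => exact: event_even_comp
  | |- is_event (fun x => finite_run (@?f x)) => exact: event_finite_comp
  | _ => first [assumption | event_atom]
  end.

Definition rayR (R : realType) (T : int -> R) (j : int) : nat -> R :=
  fun n => T (j + n%:Z).
Definition rayL (R : realType) (T : int -> R) (j : int) : nat -> R :=
  fun n => T (j - n%:Z).

(** * Monotone chains of times *)
Section Squeeze.
Variable R : realType.

(** A form of the vanishing derivative criterion: on a piece of length d the
    function g moves by at most d times the increment of h, so over equal
    pieces the total is d times a telescoping sum, and d is arbitrarily small. *)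
Lemma eq_of_osc_le (g h : R -> R) (t : R) : 0 <= t ->
    (forall a b, 0 <= a -> a <= b -> b <= t ->
      `|g b - g a| <= (b - a) * (h b - h a)) ->
  g t = g 0.
Proof.
move=> t0 osc.
have main (M : nat) : `|g t - g 0| <= (t / M.+1%:R) * (h t - h 0).
  (* Cut [0, t] into M.+1 equal pieces; the increments of h telescope. *)
  have M0 : 0 < M.+1%:R :> R by rewrite ltr0n.
  pose p i := t * (i%:R / M.+1%:R).
  have pS i : p i.+1 - p i = t / M.+1%:R.
    by rewrite /p -mulrBr -mulrBl -natrB// subSnn mul1r.
  have pM : p M.+1 = t by rewrite /p divff ?mulr1// gt_eqF.
  have p0 : p 0%N = 0 by rewrite /p mul0r mulr0.
  suff H i : (i <= M.+1)%N -> `|g (p i) - g 0| <= (t / M.+1%:R) * (h (p i) - h 0).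
    by have := H M.+1 (leqnn _); rewrite pM.
  elim: i => [|i IH] iM.
    by rewrite p0 !subrr normr0 mulr0.
  have {}IH := IH (ltnW iM).
  have ple : p i.+1 <= t.
    by rewrite /p ler_piMr// ler_pdivrMr// mul1r ler_nat.
  have pi0 : 0 <= p i by rewrite /p mulr_ge0// divr_ge0// ltW.
  have pile : p i <= p i.+1 by rewrite -subr_ge0 pS divr_ge0// ltW.
  have := osc _ _ pi0 pile ple; rewrite pS => o.
  have -> : g (p i.+1) - g 0 = (g (p i.+1) - g (p i)) + (g (p i) - g 0) by ring.
  apply: (le_trans (ler_normD _ _)).
  apply: (le_trans (lerD o IH)).
  by rewrite -mulrDr; apply: ler_wpM2l; [rewrite divr_ge0// ltW|lra].
apply/eqP; rewrite -subr_eq0 -normr_le0 leNgt; apply/negP => gt0.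
set e := `|_| in gt0 main.
have := main 0%N; rewrite divr1 => m0.
have c0 : 0 <= t * (h t - h 0) by rewrite (le_trans _ m0)// ltW.
pose M := Num.truncn (t * (h t - h 0) / e).
have := main M; rewrite mulrAC ler_pdivlMr ?ltr0n// => mM.
have : t * (h t - h 0) / e < M.+1%:R by apply: truncnS_gt; rewrite divr_ge0// ltW.
by rewrite ltr_pdivrMr// [_%:R * e]mulrC ltNge mM.
Qed.

(** The increment of x^(n+1)/(n+1)! over [a, b] lies between its extreme
    slopes, by the factorisation of b^(n+1) - a^(n+1). *)
Lemma pow_slope (a b : R) (n : nat) : 0 <= a -> a <= b ->
  (b - a) * (a ^+ n / n`!%:R) <= b ^+ n.+1 / n.+1`!%:R - a ^+ n.+1 / n.+1`!%:R <=
  (b - a) * (b ^+ n / n`!%:R).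
Proof.
move=> a0 ab; have b0 := le_trans a0 ab.
rewrite -mulrBl subrXX factS natrM invfM -!mulrA.
have f0 : 0 <= n`!%:R^-1 :> R by rewrite invr_ge0.
have n0 : 0 < n.+1%:R :> R by rewrite ltr0n.
have s0 : 0 <= b - a by rewrite subr_ge0.
apply/andP; split; apply: ler_wpM2l => //; rewrite mulrA; apply: ler_wpM2r => //.
  rewrite ler_pdivlMr//.
  have -> : a ^+ n * n.+1%:R = \sum_(i < n.+1) a ^+ n.
    by rewrite sumr_const card_ord mulr_natr.
  apply: ler_sum => i _; rewrite -[in leLHS](subnK (ltnSE (ltn_ord i))) exprD /=.
  by apply: ler_wpM2r; [exact: exprn_ge0|apply: lerXn2r => //; rewrite nnegrE].
rewrite ler_pdivrMr//.
have -> : b ^+ n * n.+1%:R = \sum_(i < n.+1) b ^+ n.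
  by rewrite sumr_const card_ord mulr_natr.
apply: ler_sum => i _; rewrite -[in leRHS](subnK (ltnSE (ltn_ord i))) exprD /=.
by apply: ler_wpM2l; [exact: exprn_ge0|apply: lerXn2r => //; rewrite nnegrE].
Qed.

End Squeeze.

Section AlmostSure.
Context d (Omega : measurableType d) (R : realType) (P : probability Omega R).
Variables (I : choiceType) (X : I -> {RV P >-> R}).
Implicit Types phi psi : (I -> R) -> bool.

Lemma prob_eq1 phi : is_event phi -> prob X (fun x => ~~ phi x) = 0 -> prob X phi = 1.
Proof. by move=> mphi; rewrite prob_neg//; lra. Qed.

Lemma prob_and1 phi psi : is_event phi -> is_event psi -> prob X phi = 1 ->
  prob X (fun x => phi x && psi x) = prob X psi.
Proof.
move=> mphi mpsi p1; apply: (prob_ae mphi _ mpsi p1); first exact: event_and.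
by move=> x ->.
Qed.

Lemma prob_all1 (phi : nat -> (I -> R) -> bool) :
  (forall n, is_event (phi n)) -> (forall n, prob X (phi n) = 1) ->
  prob X (fun x => `[< forall n, phi n x >]) = 1.
Proof.
move=> mphi p1; apply: prob_eq1; first exact: event_all.
apply: EFin_inj; rewrite -probE; last by apply: event_neg; exact: event_all.
rewrite (_ : mkset _ = \bigcup_n [set w | ~~ phi n (fun i => X i w)]).
  have mn n : measurable [set w | ~~ phi n (fun i => X i w)].
    by apply: (@measurable_event _ _ _ _ _ _ (fun x => ~~ phi n x)); exact: event_neg.
  apply/negligibleP; first exact: bigcupT_measurable.
  apply: negligible_bigcup => n; apply/negligibleP => //.
  have := @probE _ _ _ P _ X (fun x => ~~ phi n x) (event_neg (mphi n)).
  by rewrite prob_neg// p1 subrr.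
apply/seteqP; split => w /=.
  move=> /asboolPn h; apply: contrapT => h'; apply: h => n.
  by apply: contrapT => /negP pn; apply: h'; exists n.
by move=> [n _ /= /negP pn]; apply/asboolPn => /(_ n).
Qed.

End AlmostSure.

Section Chains.
Context d (Omega : measurableType d) (R : realType) (P : probability Omega R).
Variable tau : int -> {RV P >-> R}.
Hypothesis htau : iid_uniform01 tau.
Local Notation pr := (prob tau).

Lemma prob_shift (j : int) phi : is_event phi ->
  pr (fun T => phi (fun i => T (i + j))) = pr phi.
Proof.
move=> mphi.
exact: (prob_reindex (f := fun i => i + j) (g := id) htau (addIr j) (@inj_id _) mphi).
Qed.

Lemma prob_refl (j : int) phi : is_event phi ->
  pr (fun T => phi (fun i => T (j - i))) = pr phi.
Proof.
move=> mphi.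
have inj : injective (fun i : int => j - i) by move=> a b; lia.
exact: (prob_reindex (f := fun i => j - i) (g := id) htau inj (@inj_id _) mphi).
Qed.

Lemma inj_rayL (j : int) : injective (fun n : nat => j - n%:Z).
Proof. by move=> a b; lia. Qed.

Lemma inj_rayR (j : int) : injective (fun n : nat => j + n%:Z).
Proof. by move=> a b; lia. Qed.

Lemma prob_rayL (i j : int) phi : is_event phi ->
  pr (fun T => phi (rayL T i)) = pr (fun T => phi (rayR T j)).
Proof.
by move=> m; exact: (prob_reindex htau (@inj_rayL i) (@inj_rayR j) m).
Qed.

(** Half-lines on the two sides of an edge involve disjoint sets of
    times. *)
Lemma prob_half_indep (i j : int) phi psi : i < j -> is_event phi -> is_event psi ->
  pr (fun T => phi (rayL T i) && psi (rayR T j)) =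
  pr (fun T => phi (rayL T i)) * pr (fun T => psi (rayR T j)).
Proof.
move=> ij mphi mpsi.
apply: (prob_indep htau (@inj_rayL i) (@inj_rayR j)) => //.
by move=> a b; lia.
Qed.

Definition chain (t : R) (k : nat) (x : nat -> R) := (x 0%N <= t) && run_ge x k.

Lemma event_chain t k : is_event (chain t k).
Proof. by apply: event_and; [exact: event_le|exact: event_run]. Qed.

(** Let D be the probability as a function of t, for k + 1 steps. If the first
    time falls in the interval from a to b, then the rest of the chain lies below b,
    and it certainly fits if it lies below a. By independence and induction,
    D b - D a lies between (b - a) * H a and (b - a) * H b, and by [pow_slope] so
    does the increment of F. As F and D vanish at 0, [eq_of_osc_le]
    identifies them. *)
Lemma prob_chain (j : int) (t : R) k : 0 <= t <= 1 ->
  pr (fun T => chain t k (rayR T j)) = t ^+ k.+1 / k.+1`!%:R.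
Proof.
elim: k j t => [|k IH] j t t01.
  rewrite expr1 factS fact0 muln1 divr1 -[RHS](prob_coord_le j htau t01).
  congr prob; apply/funext => T.
  by rewrite /chain run_ge0 andbT /rayR addr0.
have [t0 t1] := andP t01.
pose D a := pr (fun T => chain a k.+1 (rayR T j)).
pose H a : R := a ^+ k.+1 / k.+1`!%:R.
pose F a : R := a ^+ k.+2 / k.+2`!%:R.
have mD a : is_event (fun T : int -> R => chain a k.+1 (rayR T j)).
  exact: (event_reindex _ (event_chain a k.+1)).
suff : D t - F t = D 0 - F 0.
  have -> : D 0 = 0.
    apply/eqP; rewrite eq_le prob_ge0 andbT.
    rewrite -[leRHS](@prob_coord_le _ _ _ _ _ tau j 0 htau) ?lexx ?ler01//.
    apply: prob_le => [//| |T]; first exact: event_le.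
    by rewrite /chain /rayR addr0 => /andP[].
  rewrite /F expr0n mul0r; rewrite /D; lra.
apply: (@eq_of_osc_le _ (fun a => D a - F a) H t t0) => a b a0 ab bt.
have b0 := le_trans a0 ab.
have a01 : 0 <= a <= 1 by rewrite a0 (le_trans ab)// (le_trans bt).
have b01 : 0 <= b <= 1 by rewrite b0 (le_trans bt).
have slopes : (b - a) * H a <= D b - D a <= (b - a) * H b.
  have mab : is_event (fun x : nat -> R => (x 0%N <= b) && ~~ (x 0%N <= a)).
    by event.
  have Eab : pr (fun T => (rayL T j 0%N <= b) && ~~ (rayL T j 0%N <= a)) = b - a.
    have := prob_split tau (@event_le R int j b) (@event_le R int j a).
    rewrite prob_coord_le//.
    rewrite [X in X + _](_ : _ = a); last first.
      rewrite -[RHS](prob_coord_le j htau a01); congr prob; apply/funext => T.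
      by case: (leP (T j) a) => h; rewrite ?andbT ?andbF// (le_trans h ab).
    rewrite (_ : (fun T : int -> R => (rayL T j 0%N <= b) && ~~ (rayL T j 0%N <= a)) =
      fun T => (T j <= b) && ~~ (T j <= a)).
      by move=> ?; lra.
    by apply/funext => T; rewrite /rayL subr0.
  have E c : 0 <= c <= 1 -> pr (fun T => ((rayL T j 0%N <= b) && ~~ (rayL T j 0%N <= a))
       && chain c k (rayR T (j + 1))) = (b - a) * H c.
    move=> c01.
    rewrite (prob_half_indep (i := j) _ mab (event_chain c k)) ?Eab ?IH//; lia.
  have mE c : is_event (fun T : int -> R => ((rayL T j 0%N <= b) && ~~ (rayL T j 0%N <= a))
       && chain c k (rayR T (j + 1))).
    by apply: event_and; [rewrite /rayL; event|exact: (event_reindex _ (event_chain c k))].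
  have -> : D b - D a = pr (fun T => chain b k.+1 (rayR T j) && ~~ (T j <= a)).
    rewrite /D (prob_split tau (mD b) (@event_le R int j a)).
    rewrite [X in X + _ - _](_ : _ = D a); first by rewrite addrC addKr.
    congr prob; apply/funext => T; rewrite /chain /rayR addr0.
    by case: (leP (T j) a) => h; rewrite ?andbT ?andbF// (le_trans h ab).
  have mdiff : is_event (fun T : int -> R => chain b k.+1 (rayR T j) && ~~ (T j <= a)).
    by apply: event_and => //; event.
  have shiftE (T : int -> R) : (fun n => rayR T j n.+1) = rayR T (j + 1).
    by apply/funext => n; rewrite /rayR; congr T; lia.
  rewrite -!E//; apply/andP; split; apply: prob_le => // T;
    rewrite /chain run_geSl shiftE /rayL /rayR addr0 subr0.
    move=> /andP[/andP[-> nTa] /andP[T1 ->]]; rewrite nTa andbT /= andbT.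
    by apply: (le_lt_trans T1); rewrite ltNge.
  move=> /andP[/andP[Tb /andP[T1 ->]] ->]; rewrite Tb andbT /=.
  by rewrite (ltW (lt_le_trans T1 Tb)).
have := slopes; have := pow_slope k.+1 a0 ab; rewrite -/(H a) -/(H b) -/(F a) -/(F b).
rewrite mulrBr ler_norml; lra.
Qed.

End Chains.

(** * Generic configurations *)
Section Generic.
Variable R : realType.
Implicit Types (T : int -> R) (j : int).

Definition generic_at T j :=
  [&& 0 <= T j, T j <= 1, (T j < T (j + 1)) || (T (j + 1) < T j),
      finite_run (rayL T j) & finite_run (rayR T j)].

(** The sites are listed as n and Negz n to make this a countable
    intersection of events. *)
Definition generic T := `[< forall n : nat, generic_at T n%:Z && generic_at T (Negz n) >].

Lemma genericP T j : generic T -> generic_at T j.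
Proof. by move=> /asboolP g; case: j => n; have /andP[] := g n. Qed.

Lemma event_generic_at j : is_event (fun T => generic_at T j).
Proof.
rewrite /generic_at /rayL /rayR.
have m : is_event (fun T => (T j < T (j + 1)) || (T (j + 1) < T j)).
  by apply: measurable_or; exact: event_lt.
by event.
Qed.

Lemma event_generic : is_event generic.
Proof. by apply: event_all => n; apply: event_and; exact: event_generic_at. Qed.

Lemma generic01 T j : generic T -> 0 <= T j <= 1.
Proof. by move=> /(genericP j) /and5P[-> ->]. Qed.

Lemma generic_ltN T j : generic T -> ~~ (T j < T (j + 1)) = (T (j + 1) < T j).
Proof.
move=> /(genericP j) /and5P[_ _ + _ _]; case: ltgtP => //.
Qed.

Lemma rayL_S T j : (fun n => rayL T j n.+1) = rayL T (j - 1).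
Proof. by apply/funext => n; rewrite /rayL; congr T; lia. Qed.

Lemma rayR_S T j : (fun n => rayR T j n.+1) = rayR T (j + 1).
Proof. by apply/funext => n; rewrite /rayR; congr T; lia. Qed.

Definition le_even T j := even_run (rayL T j).
Definition re_even T j := even_run (rayR T j).

Lemma le_evenE T j : generic T ->
  le_even T j = ~~ ((T (j - 1) < T j) && le_even T (j - 1)).
Proof.
move=> /(genericP j) /and5P[_ _ _ fL _].
by rewrite /le_even even_runE// rayL_S {1 2}/rayL subr0.
Qed.

Lemma re_evenE T j : generic T ->
  re_even T j = ~~ ((T (j + 1) < T j) && re_even T (j + 1)).
Proof.
move=> /(genericP j) /and5P[_ _ _ _ fR].
by rewrite /re_even even_runE// rayR_S {1 2}/rayR addr0.
Qed.

Lemma event_le_even j : is_event (fun T => le_even T j).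
Proof. exact: event_even_comp. Qed.

Lemma event_re_even j : is_event (fun T => re_even T j).
Proof. exact: event_even_comp. Qed.

Lemma event_runR j k : is_event (fun T => run_ge (rayR T j) k).
Proof. exact: event_run_comp. Qed.

Lemma run_rayRS T j k :
  run_ge (rayR T j) k.+1 = (T (j + 1) < T j) && run_ge (rayR T (j + 1)) k.
Proof. by rewrite run_geSl rayR_S /rayR addr0. Qed.

Lemma run_rayLS T j k :
  run_ge (rayL T j) k.+1 = (T (j - 1) < T j) && run_ge (rayL T (j - 1)) k.
Proof. by rewrite run_geSl rayL_S /rayL subr0. Qed.

End Generic.

Section GenericSure.
Context d (Omega : measurableType d) (R : realType) (P : probability Omega R).
Variable tau : int -> {RV P >-> R}.
Hypothesis htau : iid_uniform01 tau.
Local Notation pr := (prob tau).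

Lemma prob_coord_le1 j : pr (fun T => T j <= 1) = 1.
Proof. by rewrite prob_coord_le// ler01 lexx. Qed.

Lemma prob_runR j k : pr (fun T => run_ge (rayR T j) k) = k.+1`!%:R^-1.
Proof.
have := @prob_chain _ _ _ _ _ htau j 1 k; rewrite ler01 lexx expr1n mul1r => <-//.
rewrite -(prob_and1 (event_le _ _) (event_runR _ _) (prob_coord_le1 j)).
by congr prob; apply/funext => T; rewrite /chain /rayR addr0.
Qed.

Lemma prob_runL j k : pr (fun T => run_ge (rayL T j) k) = k.+1`!%:R^-1.
Proof. by rewrite (prob_rayL htau j 0 (@event_run R k)) prob_runR. Qed.

Lemma ex_invfact_lt (e : R) : 0 < e -> exists k : nat, k.+1`!%:R^-1 < e.
Proof.
move=> e0; pose k := Num.truncn e^-1; exists k.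
have h : e^-1 < k.+1%:R by apply: truncnS_gt; rewrite invr_ge0 ltW.
rewrite -[e]invrK ltf_pV2 ?posrE ?invr_gt0// ?ltr0n ?fact_gt0//.
apply: (lt_le_trans h); rewrite ler_nat factS.
by rewrite leq_pmulr// fact_gt0.
Qed.

(** A run of length k has probability 1/(k+1)!, hence an infinite run has
    probability 0. *)
Lemma prob_finiteR j : pr (fun T => finite_run (rayR T j)) = 1.
Proof.
have m : is_event (fun T : int -> R => finite_run (rayR T j)) by exact: event_finite_comp.
apply: prob_eq1 => //; apply/eqP; rewrite eq_le prob_ge0 andbT leNgt.
apply/negP => /ex_invfact_lt[k]; rewrite ltNge -(prob_runR j k) => /negP; apply.
apply: prob_le; [exact: event_neg|exact: event_runR|move=> T].
by apply: contraNT => nr; apply/asboolP; exists k.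
Qed.

Lemma prob_finiteL j : pr (fun T => finite_run (rayL T j)) = 1.
Proof. by rewrite (prob_rayL htau j 0 (@event_finite R)) prob_finiteR. Qed.

(** Each strict order of two neighbouring times has probability 1/2, so
    nothing is left for a tie. *)
Lemma prob_adj_neq j : pr (fun T => (T j < T (j + 1)) || (T (j + 1) < T j)) = 1.
Proof.
have m : is_event (fun T : int -> R => (T j < T (j + 1)) || (T (j + 1) < T j)).
  by apply: measurable_or; exact: event_lt.
rewrite (prob_split tau m (@event_lt R int j (j + 1))).
have r1 : pr (fun T => T (j + 1) < T j) = 2^-1.
  rewrite -[RHS](prob_runR j 1); congr prob; apply/funext => T.
  by rewrite run_rayRS run_ge0 andbT.
have l1 : pr (fun T => T j < T (j + 1)) = 2^-1.
  rewrite -[RHS](prob_runL (j + 1) 1); congr prob; apply/funext => T.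
  by rewrite run_rayLS run_ge0 andbT addrK.
rewrite [X in X + _](_ : _ = 2^-1); last first.
  by rewrite -[RHS]l1; congr prob; apply/funext => T; case: ltgtP.
rewrite [X in _ + X](_ : _ = 2^-1); first by lra.
by rewrite -[RHS]r1; congr prob; apply/funext => T; case: ltgtP.
Qed.

Lemma prob_generic : pr (@generic R) = 1.
Proof.
have H j : pr (fun T => generic_at T j) = 1.
  have m : is_event (fun T : int -> R => (T j < T (j + 1)) || (T (j + 1) < T j)).
    by apply: measurable_or; exact: event_lt.
  have mL : is_event (fun T : int -> R => finite_run (rayL T j)) by exact: event_finite_comp.
  have mR : is_event (fun T : int -> R => finite_run (rayR T j)) by exact: event_finite_comp.
  rewrite /generic_at prob_and1 ?prob_coord_ge0//; last 2 first.
  - exact: event_ge.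
  - by event.
  rewrite prob_and1 ?prob_coord_le1//; last 2 first.
  - exact: event_le.
  - by event.
  rewrite prob_and1 ?prob_adj_neq//; last by event.
  by rewrite prob_and1 ?prob_finiteL ?prob_finiteR.
apply: prob_all1 => n; first by apply: event_and; exact: event_generic_at.
by rewrite prob_and1 ?H//; exact: event_generic_at.
Qed.

Lemma prob_eq_generic phi psi : is_event phi -> is_event psi ->
  (forall T, generic T -> phi T = psi T) -> pr phi = pr psi.
Proof. by move=> m1 m2 h; exact: (prob_ae (@event_generic R) m1 m2 prob_generic h). Qed.

End GenericSure.

(** * Occupation seen from one side *)
Section Halves.
Variables (R : realType) (t : R).
Implicit Types (T : int -> R) (j : int) (x : nat -> R).

Definition occL T j := (T j <= t) && le_even T j.
Definition occR T j := (T j <= t) && re_even T j.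

(** The event that a site is occupied from the left and starts a right
    run of length at least k, with the times listed along the half-line that
    starts at the end of this run: the site itself has position k. In this form
    the event depends on one ray, and its mirror image is the same event on a
    ray in the opposite direction. *)
Definition half_event (k : nat) x :=
  [&& x k <= t, even_run (fun n => x (k + n)%N) & run_ge (fun n => x (k - n)%N) k].

Lemma event_half k : is_event (half_event k).
Proof. by rewrite /half_event; event. Qed.

Lemma event_occL j : is_event (fun T => occL T j).
Proof. by apply: event_and; [exact: event_le|exact: event_le_even]. Qed.

Lemma event_occR j : is_event (fun T => occR T j).
Proof. by apply: event_and; [exact: event_le|exact: event_re_even]. Qed.

Lemma half_event_rayL T j k :
  half_event k (rayL T (j + k%:Z)) = occL T j && run_ge (rayR T j) k.
Proof.
rewrite /half_event /occL /le_even -andbA {1}/rayL addrK; congr [&& _, _ & _].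
  by congr even_run; apply/funext => n; rewrite /rayL; congr T; lia.
by apply: eq_run_ge => i ik; rewrite /rayL /rayR; congr T; lia.
Qed.

Lemma half_event_rayR T j k :
  half_event k (rayR T (j - k%:Z)) = occR T j && run_ge (rayL T j) k.
Proof.
rewrite /half_event /occR /re_even -andbA {1}/rayR subrK; congr [&& _, _ & _].
  by congr even_run; apply/funext => n; rewrite /rayR; congr T; lia.
by apply: eq_run_ge => i ik; rewrite /rayL /rayR; congr T; lia.
Qed.

End Halves.

Ltac event_atom ::= lazymatch goal with
  | |- is_event (fun x => occL _ x _) => exact: event_occL
  | |- is_event (fun x => occR _ x _) => exact: event_occR
  | |- is_event (fun x => le_even x _) => exact: event_le_even
  | |- is_event (fun x => re_even x _) => exact: event_re_even
  end.

Section OneSided.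
Context d (Omega : measurableType d) (R : realType) (P : probability Omega R).
Variable tau : int -> {RV P >-> R}.
Hypothesis htau : iid_uniform01 tau.
Variable t : R.
Hypothesis t01 : 0 <= t <= 1.
Local Notation pr := (prob tau).

Definition occ_run (k : nat) := pr (fun T => occL t T 0 && run_ge (rayR T 0) k).

Local Notation A := occ_run.

Lemma prob_half_rayR j k : pr (fun T => half_event t k (rayR T j)) = A k.
Proof.
rewrite -(prob_rayL htau (0 + k%:Z) j (event_half t k)).
by congr prob; apply/funext => T; rewrite half_event_rayL.
Qed.

Lemma prob_half_rayL j k : pr (fun T => half_event t k (rayL T j)) = A k.
Proof. by rewrite (prob_rayL htau j j (event_half t k)) prob_half_rayR. Qed.

Lemma prob_occL j k : pr (fun T => occL t T j && run_ge (rayR T j) k) = A k.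
Proof.
by rewrite -(prob_half_rayL (j + k%:Z) k); congr prob; apply/funext => T; rewrite half_event_rayL.
Qed.

Lemma prob_occR j k : pr (fun T => occR t T j && run_ge (rayL T j) k) = A k.
Proof.
by rewrite -(prob_half_rayR (j - k%:Z) k); congr prob; apply/funext => T; rewrite half_event_rayR.
Qed.

(** The half-lines that end at i + k and start at j - l are disjoint. *)
Lemma prob_occL_occR (i j : int) k l : i + k%:Z < j - l%:Z ->
  pr (fun T => (occL t T i && run_ge (rayR T i) k) &&
               (occR t T j && run_ge (rayL T j) l)) = A k * A l.
Proof.
move=> lt.
have := prob_half_indep htau lt (event_half t k) (event_half t l).
rewrite prob_half_rayL prob_half_rayR => <-.
by congr prob; apply/funext => T; rewrite half_event_rayL half_event_rayR.
Qed.

Local Notation D k := (t ^+ k.+1 / k.+1`!%:R).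

Lemma occ_run_le k : A k <= D k.
Proof.
rewrite -(prob_chain htau 0 k t01); apply: prob_le; first by event.
  exact: (event_reindex _ (event_chain t k)).
by move=> T /andP[/andP[T0 _] r]; rewrite /chain r andbT /rayR addr0.
Qed.

(** Let -1 be occupied from the left, and let the chain T 0 > ... > T k below t
    start at 0: these are independent events. If T (-1) < T 0, the chain is there
    while the left run of 0 is odd; if T (-1) > T 0, the site -1 starts a
    chain that is one step longer. *)
Lemma occ_run_rec k : A 0 * D k = D k - A k + A k.+1.
Proof.
have mc : is_event (fun T : int -> R => chain t k (rayR T 0)).
  exact: (event_reindex _ (event_chain t k)).
rewrite -(prob_chain htau 0 k t01) -(prob_half_rayL (-1) 0).
rewrite -(prob_half_indep (i := -1) (j := 0) htau _ (event_half t 0) (event_chain t k))//.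
have -> : pr (fun T => half_event t 0 (rayL T (-1)) && chain t k (rayR T 0)) =
          pr (fun T => occL t T (-1) && chain t k (rayR T 0)).
  congr prob; apply/funext => T.
  by rewrite -[-1]addr0 half_event_rayL run_ge0 andbT addr0.
rewrite (prob_split tau (psi := fun T => T (-1) < T 0)); last 2 first.
- by event.
- by event.
congr (_ + _).
  rewrite [in RHS](prob_split tau mc (@event_le_even R 0)).
  have -> : A k = pr (fun T => chain t k (rayR T 0) && le_even T 0).
    rewrite /occ_run; congr prob; apply/funext => T.
    by rewrite /occL /chain {2}/rayR addr0 andbAC.
  rewrite addrC addrA addNr add0r.
  apply: (prob_eq_generic htau); [by event|by event|].
  move=> T gT; rewrite le_evenE// sub0r negbK /chain {1 3}/rayR addr0 /occL.
  case: (T (-1) < T 0) / boolP => h; rewrite ?andbF//= andbT.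
  case: (leP (T 0) t) => T0t; rewrite ?andbF//=.
  by rewrite (ltW (lt_le_trans h T0t)) /= andbC.
rewrite -(prob_occL (-1) k.+1).
apply: (prob_eq_generic htau); [by event|by event|].
move=> T gT; rewrite run_rayRS addNr.
have := @generic_ltN _ T (-1) gT; rewrite addNr => ->.
rewrite /chain {1}/rayR addr0 /occL.
case: (T 0 < T (-1)) / boolP => h; rewrite ?andbF//= andbT.
case: (leP (T (-1)) t) => T1t //=.
by rewrite (ltW (lt_le_trans h T1t)).
Qed.

Lemma one_sub_occ_run k : 1 - A k = (1 - A 0) * series (exp_coeff t) k.+1.
Proof.
elim: k => [|k IH].
  by rewrite /series/= big_nat1 /exp_coeff/= expr0 fact0 divr1 mulr1.
have -> : series (exp_coeff t) k.+2 = series (exp_coeff t) k.+1 + D k.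
  by rewrite /series/= big_nat_recr.
rewrite mulrDr -IH mulrBl occ_run_rec; ring.
Qed.

Lemma cvg_occ_run : A k @[k --> \oo] --> (0 : R).
Proof.
apply: (squeeze_cvgr (f := fun=> 0) (h := fun k => exp_coeff t k.+1)).
- by near=> k; rewrite prob_ge0/= /exp_coeff/= occ_run_le.
- exact: cvg_cst.
- by rewrite (cvg_shiftS (exp_coeff t)); exact: cvg_exp_coeff.
Unshelve. all: by end_near. Qed.

(** In the limit k -> oo of [one_sub_occ_run] the left side becomes 1. *)
Lemma one_sub_occ_run0 : 1 - A 0 = expR (- t).
Proof.
have h1 : (1 - A k) @[k --> \oo] --> (1 - 0 : R).
  by apply: cvgB; [exact: cvg_cst|exact: cvg_occ_run].
have h2 : (1 - A k) @[k --> \oo] --> (1 - A 0) * expR t.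
  under eq_fun do rewrite one_sub_occ_run.
  apply: cvgMl_tmp.
  rewrite (cvg_shiftS (series (exp_coeff t))).
  exact: is_cvg_series_exp_coeff.
have := cvg_unique _ h1 h2; rewrite subr0 => e.
by rewrite expRN -[RHS]mul1r; apply: (canRL (mulfK _)); [rewrite gt_eqF ?expR_gt0|rewrite -e].
Qed.

Lemma occ_runE k : A k = 1 - expR (- t) * series (exp_coeff t) k.+1.
Proof. by rewrite -one_sub_occ_run0 -one_sub_occ_run; ring. Qed.

End OneSided.

(** * Two runs that face each other *)
Section ShiftReflect.
Variable R : realType.
Implicit Types (T : int -> R).

Lemma run_ge_last (x : nat -> R) k : run_ge x k -> x k <= x 0%N.
Proof.
elim: k => [//|k IH]; rewrite run_geS => /andP[/IH xk /ltW h].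
exact: le_trans xk.
Qed.

Lemma rayL_shift T j i : rayL (fun i => T (i + j)) i = rayL T (i + j).
Proof. by apply/funext => n; rewrite /rayL; congr T; lia. Qed.
Lemma rayR_shift T j i : rayR (fun i => T (i + j)) i = rayR T (i + j).
Proof. by apply/funext => n; rewrite /rayR; congr T; lia. Qed.
Lemma rayL_refl T j i : rayL (fun i => T (j - i)) i = rayR T (j - i).
Proof. by apply/funext => n; rewrite /rayL /rayR; congr T; lia. Qed.
Lemma rayR_refl T j i : rayR (fun i => T (j - i)) i = rayL T (j - i).
Proof. by apply/funext => n; rewrite /rayL /rayR; congr T; lia. Qed.

End ShiftReflect.

(** Turns the relation between a parity and its tail into an alternating
    sum over run lengths. *)
Lemma alternating_telescope (R : pzRingType) (g h : nat -> R) n :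
    (forall k, (k <= n)%N -> g k + g k.+1 = h k) -> g n.+1 = 0 ->
  g 0%N = \sum_(k < n.+1) (-1) ^+ k * h k.
Proof.
move=> gh gn.
have H m : (m <= n.+1)%N -> g 0%N = \sum_(k < m) (-1) ^+ k * h k + (-1) ^+ m * g m.
  elim: m => [|m IH] mn; first by rewrite big_ord0 add0r mul1r.
  rewrite IH ?(ltnW mn)// big_ord_recr/= -gh// mulrDr -!addrA; congr (_ + _).
  by rewrite exprS mulN1r mulNr addrN addr0.
by rewrite (H n.+1 (leqnn _)) gn mulr0 addr0.
Qed.

Lemma andb_regroup_right a b c d e :
  (a && b) && (c && (d && e)) = ((a && b) && (c && d)) && e.
Proof. by rewrite !andbA. Qed.

Lemma andb_regroup_left a b c d e :
  (a && (b && e)) && (c && d) = ((a && b) && (c && d)) && e.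
Proof. by case: e; rewrite ?andbT ?andbF. Qed.

Section TwoSided.
Context d (Omega : measurableType d) (R : realType) (P : probability Omega R).
Variable tau : int -> {RV P >-> R}.
Hypothesis htau : iid_uniform01 tau.
Variable t : R.
Hypothesis t01 : 0 <= t <= 1.
Local Notation pr := (prob tau).
Local Notation A := (occ_run tau t).
Local Notation lam := (occL t).
Local Notation rho := (occR t).

(** Site 0 is occupied from the left and starts a right run of length at
    least k; site s is occupied from the right and starts a left run of length
    at least l. *)
Definition two_runs (s k l : nat) := pr (fun T =>
  (lam T 0 && run_ge (rayR T 0) k) && (rho T s%:Z && run_ge (rayL T s%:Z) l)).

Lemma two_runs_disjoint s k l : (k + l < s)%N -> two_runs s k l = A k * A l.
Proof. by move=> kls; apply: prob_occL_occR => //; lia. Qed.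

(** The two runs cover the interval from 0 to s and share its minimum,
    at site k. *)
Definition valley (s k : nat) := two_runs s k (s - k).

(** Without a condition on the edge from k to k + 1 the two runs are
    disjoint. The order of the two times at this edge decides which of the runs
    extends over it. *)
Lemma valley_split s k : (k <= s)%N ->
  valley s.+1 k + valley s.+1 k.+1 = A k * A (s - k).
Proof.
move=> ks; rewrite -(@two_runs_disjoint s.+1); last by lia.
rewrite /valley /two_runs [in RHS](prob_split tau
  (psi := fun T => T k%:Z < T (k%:Z + 1))); last 2 first.
- by event.
- by event.
congr (_ + _).
  congr prob; apply/funext => T; rewrite subSn// run_geS andb_regroup_right.
  by congr andb; rewrite /rayL; congr (T _ < T _); lia.
rewrite subSS; apply: (prob_eq_generic htau); [by event|by event|].
move=> T gT; rewrite generic_ltN// run_geS /rayR.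
have -> : 0 + k%:Z = k%:Z by rewrite add0r.
have -> : 0 + k.+1%:Z = k%:Z + 1 by lia.
exact: andb_regroup_left.
Qed.

(** Reflection of the interval from 0 to s. *)
Lemma valley_ends s : valley s s = valley s 0.
Proof.
have m : is_event (fun T : int -> R => (lam T 0 && run_ge (rayR T 0) s) &&
    (rho T s%:Z && run_ge (rayL T s%:Z) 0)) by event.
rewrite /valley /two_runs subnn subn0 -(prob_refl htau s%:Z m).
congr prob; apply/funext => T.
rewrite /occL /occR /le_even /re_even !rayL_refl !rayR_refl !subr0 subrr !run_ge0 !andbT.
exact: andbC.
Qed.

(** The chain T 0 < ... < T s of a site s that is occupied from the right
    has total probability A s. If the left run of 0 is even, this is a valley with
    minimum at 0; if it is odd, then T (-1) < T 0 and -1 is occupied from the left,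
    so that the chain from -1 is such a valley, one site longer. *)
Lemma valley_start s : valley s 0 + valley s.+1 0 = A s.
Proof.
rewrite -(prob_occR htau t s%:Z s) (prob_split tau (psi := fun T => le_even T 0)); last 2 first.
- by event.
- by event.
have chain_le T : T s%:Z <= t -> run_ge (rayL T s%:Z) s -> T 0 <= t.
  move=> Ts /run_ge_last; rewrite /rayL subrr subr0 => h.
  exact: le_trans Ts.
congr (_ + _).
  rewrite /valley /two_runs subn0; congr prob; apply/funext => T.
  rewrite run_ge0 andbT /occL [RHS]andbC.
  case: (boolP (rho T s%:Z && _)) => [/andP[/andP[Ts _] r]|]; last by rewrite !andbF.
  by rewrite (chain_le T Ts r).
rewrite /valley /two_runs subn0 -(prob_shift htau (-1)); last by event.
apply: (prob_eq_generic htau); [|by event|].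
  rewrite (_ : (fun T : int -> R => _) = fun T =>
      lam T (-1) && (rho T s%:Z && run_ge (rayL T s%:Z) s.+1)).
    by event.
  apply/funext => T; rewrite /occL /occR /le_even /re_even !rayL_shift !rayR_shift.
  rewrite sub0r run_ge0 andbT.
  by have -> : s.+1%:Z - 1 = s%:Z by lia.
move=> T gT.
rewrite le_evenE// negbK sub0r.
rewrite /occL /occR /le_even /re_even !rayL_shift !rayR_shift.
rewrite sub0r run_ge0 andbT.
have -> : s.+1%:Z - 1 = s%:Z by lia.
rewrite run_geS [in LHS]/rayL.
have -> : s%:Z - s.+1%:Z = -1 by lia.
rewrite subrr.
case: (T (-1) < T 0) / boolP => h; rewrite ?andbF// !andbT.
case: (boolP (run_ge _ s)) => r; rewrite ?andbF// ?andbT.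
case: (leP (T s%:Z) t) => Ts; rewrite ?andbF//=.
rewrite (ltW (lt_le_trans h (chain_le T Ts r)))/= andbC.
by rewrite andbC.
Qed.

(** The conditions for 0 and s to be both occupied at time t, grouped so
    that the two runs facing each other stand apart. *)
Definition pair_occ (s : nat) := pr (fun T =>
  (lam T 0 && re_even T 0) && (rho T s%:Z && le_even T s%:Z)).

(** G k and H k l are the hybrids in which the parity of a run is replaced
    by the parity of what follows its first k, respectively l, steps. The
    expansion in k stops at s: if the right run of 0 reaches s + 1 and what
    follows is even, then the right run of s is odd, and s is not occupied from
    the right. The expansion in l stops at s - k: beyond that the two runs would
    disagree on the edge from k - 1 to k, or, if k = 0, the left run of 0 would
    be odd. *)
Lemma pair_occ_expansion s : pair_occ s =
  \sum_(k < s.+1) (-1) ^+ k * (\sum_(l < (s - k).+1) (-1) ^+ l * two_runs s k l).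
Proof.
pose G k := pr (fun T => (lam T 0 && run_ge (rayR T 0) k) &&
  ((rho T s%:Z && le_even T s%:Z) && re_even T k%:Z)).
pose H k l := pr (fun T => (lam T 0 && run_ge (rayR T 0) k) &&
  ((rho T s%:Z && run_ge (rayL T s%:Z) l) && le_even T (s%:Z - l%:Z))).
have GS k : G k + G k.+1 = H k 0%N.
  rewrite /H (_ : (fun T : int -> R => _) = fun T => (lam T 0 && run_ge (rayR T 0) k) &&
    (rho T s%:Z && le_even T s%:Z)); last first.
    by apply/funext => T; rewrite run_ge0 andbT subr0.
  rewrite (prob_split tau (psi := fun T => re_even T k%:Z)); [|by event|by event].
  congr (_ + _).
    by congr prob; apply/funext => T; rewrite -!andbA.
  apply: (prob_eq_generic htau); [by event|by event|].
  move=> T gT; rewrite (re_evenE k%:Z)// negbK run_geS /rayR.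
  have -> : 0 + k%:Z = k%:Z by rewrite add0r.
  have -> : 0 + k.+1%:Z = k%:Z + 1 by lia.
  have -> : k.+1%:Z = k%:Z + 1 by lia.
  case: (T (k%:Z + 1) < T k%:Z) => /=; rewrite ?andbF ?andbT//.
  by rewrite !andbA.
have HS k l : H k l + H k l.+1 = two_runs s k l.
  rewrite /two_runs (prob_split tau
    (psi := fun T => le_even T (s%:Z - l%:Z))); [|by event|by event].
  congr (_ + _).
    by congr prob; apply/funext => T; rewrite -!andbA.
  apply: (prob_eq_generic htau); [by event|by event|].
  move=> T gT; rewrite (le_evenE (s%:Z - l%:Z))// negbK run_geS /rayL.
  have -> : s%:Z - l.+1%:Z = s%:Z - l%:Z - 1 by lia.
  case: (T (s%:Z - l%:Z - 1) < T (s%:Z - l%:Z)) => /=; rewrite ?andbF ?andbT//.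
  by rewrite !andbA.
have pr0 phi : is_event phi -> (forall T, generic T -> ~~ phi T) -> pr phi = 0.
  move=> mphi h; rewrite (prob_eq_generic htau (psi := fun=> false) mphi).
  - by rewrite /prob (_ : mkset _ = set0) ?measure0//; apply/seteqP; split.
  - exact: measurable_cst.
  - by move=> T gT; apply/negbTE/h.
have G_end : G s.+1 = 0.
  apply: pr0 => [|T gT]; first by event.
  rewrite run_geS /occR [re_even T s%:Z]re_evenE// /rayR.
  have -> : 0 + s%:Z = s%:Z by rewrite add0r.
  have -> : 0 + s.+1%:Z = s%:Z + 1 by lia.
  have -> : s.+1%:Z = s%:Z + 1 by lia.
  apply/negP => /andP[/andP[_ /andP[_ ->]] /andP[/andP[/andP[_ /=]]]].
  by move=> /negbTE ->.
have H_end k : (k <= s)%N -> H k (s - k).+1 = 0.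
  move=> ks; apply: pr0 => [|T gT]; first by event.
  rewrite [run_ge (rayL _ _) _]run_geS /rayL.
  have -> : s%:Z - (s - k).+1%:Z = k%:Z - 1 by lia.
  have -> : s%:Z - (s - k)%N%:Z = k%:Z by lia.
  case: k ks => [|k] ks.
    rewrite /occL (le_evenE 0)// sub0r; apply/negP.
    move=> /andP[/andP[/andP[_ no] _] /andP[/andP[_ /andP[_ h1]] h2]].
    by move: no; rewrite h1 h2.
  rewrite [run_ge (rayR _ _) _]run_geS /rayR.
  have -> : 0 + k%:Z = k%:Z by rewrite add0r.
  have -> : 0 + k.+1%:Z = k.+1%:Z by rewrite add0r.
  have -> : k.+1%:Z - 1 = k%:Z by lia.
  apply/negP => /andP[/andP[_ /andP[_ h1]] /andP[/andP[_ /andP[_ h2]] _]].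
  by move: (lt_trans h1 h2); rewrite ltxx.
have -> : pair_occ s = G 0%N.
  rewrite /pair_occ /G; congr prob; apply/funext => T.
  by rewrite run_ge0 andbT andbAC -andbA.
rewrite (alternating_telescope (h := fun k => H k 0%N) (n := s)) =>
  [|k _|//]; last exact: GS.
apply: eq_bigr => k _; congr (_ * _).
by apply: alternating_telescope => [l _|]; [exact: HS|apply: H_end; exact: ltnSE].
Qed.

End TwoSided.

(** * Convolutions of exponential sums *)
Section Convolution.
Variables (R : realType) (t q : R).

Definition conv (f g : nat -> R) s := \sum_(k < s.+1) f k * g (s - k)%N.

Local Notation x := (exp_coeff t).
Local Notation a := (fun k => 1 - q * series (exp_coeff t) k.+1).

Lemma series_expS (y : R) k :
  series (exp_coeff y) k.+2 = series (exp_coeff y) k.+1 + exp_coeff y k.+1.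
Proof. by rewrite /series/= big_nat_recr. Qed.

Lemma series_exp1 (y : R) : series (exp_coeff y) 1 = 1.
Proof. by rewrite /series/= big_nat1 /exp_coeff/= expr0 fact0 divr1. Qed.

(** Binomial theorem. *)
Lemma conv_exp n : conv x x n = exp_coeff (2 * t) n.
Proof.
rewrite /conv /exp_coeff/= mulr2n mulrDl mul1r exprDn mulr_suml.
apply: eq_bigr => i _; have lin : (i <= n)%N by rewrite -ltnS.
have fne0 m : m`!%:R != 0 :> R by rewrite pnatr_eq0 -lt0n fact_gt0.
rewrite -mulr_natr -(bin_fact lin) !natrM [t ^+ (n - i) * _]mulrC.
have bne0 : 'C(n, i)%:R != 0 :> R by rewrite pnatr_eq0 -lt0n bin_gt0.
by field; rewrite !fne0 bne0.
Qed.

Lemma conv_recr (f g : nat -> R) s :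
  conv f g s.+1 = \sum_(k < s.+1) f k * g (s - k).+1 + f s.+1 * g 0%N.
Proof.
rewrite /conv big_ord_recr/= subnn; congr (_ + _).
by apply: eq_bigr => k _; rewrite subSn// -ltnS.
Qed.

Lemma conv_recl (f g : nat -> R) s :
  conv f g s.+1 = f 0%N * g s.+1 + \sum_(k < s.+1) f k.+1 * g (s - k)%N.
Proof. by rewrite /conv big_ord_recl/= subn0. Qed.

Lemma exp_coeff_0 (y : R) : exp_coeff y 0 = 1.
Proof. by rewrite /exp_coeff/= expr0 fact0 divr1. Qed.

(** Both sides have the same increments, by [conv_exp]. *)
Lemma conv_exp_tail s :
  conv x a s = series x s.+1 - q * series (exp_coeff (2 * t)) s.+1.
Proof.
elim: s => [|s IH].
  by rewrite /conv big_ord1 !series_exp1 exp_coeff_0 mul1r.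
have step : conv x a s.+1 = conv x a s + x s.+1 - q * conv x x s.+1.
  rewrite !conv_recr exp_coeff_0 series_exp1.
  have -> : \sum_(k < s.+1) x k * (1 - q * series x (s - k).+2) =
      conv x a s - q * \sum_(k < s.+1) x k * x (s - k).+1.
    rewrite /conv mulr_sumr -sumrB; apply: eq_bigr => k _.
    by rewrite series_expS; ring.
  ring.
rewrite step IH conv_exp !series_expS; ring.
Qed.

Lemma conv_tail_step s :
  conv a a s.+1 - conv a a s = a s.+1 - q * conv x a s.+1.
Proof.
rewrite !conv_recl exp_coeff_0 series_exp1.
have -> : \sum_(k < s.+1) (1 - q * series x k.+2) * (1 - q * series x (s - k).+1) =
   conv a a s - q * \sum_(k < s.+1) x k.+1 * (1 - q * series x (s - k).+1).
  rewrite /conv mulr_sumr -sumrB; apply: eq_bigr => k _.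
  by rewrite series_expS; ring.
ring.
Qed.

End Convolution.

(** * The joint occupation probability *)
Section ClosedForm.
Context d (Omega : measurableType d) (R : realType) (P : probability Omega R).
Variable tau : int -> {RV P >-> R}.
Hypothesis htau : iid_uniform01 tau.
Variable t : R.
Hypothesis t01 : 0 <= t <= 1.
Local Notation A := (occ_run tau t).
Local Notation valley := (valley tau t).
Local Notation Q := (pair_occ tau t).
Local Notation q := (expR (- t)).
Local Notation c := (conv A A).

Definition valleys s := \sum_(k < s.+1) valley s k.

(** Summing [valley_split] over k counts every valley twice, except the two
    with minimum at an end, which have equal probability. *)
Lemma valleysS s : 2 * valleys s.+1 = 2 * valley s.+1 0 + c s.
Proof.
have -> : c s = \sum_(k < s.+1) (valley s.+1 k + valley s.+1 k.+1).
  by apply: eq_bigr => k _; rewrite (valley_split htau t01)// -ltnS.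
have first : valleys s.+1 = valley s.+1 0 + \sum_(k < s.+1) valley s.+1 k.+1.
  by rewrite /valleys big_ord_recl.
have last : valleys s.+1 = \sum_(k < s.+1) valley s.+1 k + valley s.+1 s.+1.
  by rewrite /valleys big_ord_recr.
rewrite (valley_ends htau) in last.
rewrite big_split/=; lra.
Qed.

Lemma valleys0 : valleys 0 = valley 0 0.
Proof. by rewrite /valleys big_ord1. Qed.

(** The terms with l = s - k are the valleys; all of them carry the sign
    (-1)^s. *)
Lemma pair_occE s : Q s =
  \sum_(k < s.+1) \sum_(l < s - k) (-1) ^+ (k + l) * (A k * A l) +
  (-1) ^+ s * valleys s.
Proof.
rewrite (pair_occ_expansion htau t01) /valleys mulr_sumr -big_split; apply: eq_bigr => k _ /=.
have ks : (k <= s)%N by rewrite -ltnS.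
rewrite big_ord_recr/= mulrDr mulr_sumr mulrA -exprD subnKC//; congr (_ + _).
apply: eq_bigr => l _; rewrite mulrA -exprD (two_runs_disjoint htau t01)//.
by have := ltn_ord l; lia.
Qed.

Lemma pair_occS s : Q s.+1 - Q s = (-1) ^+ s * (c s - valleys s - valleys s.+1).
Proof.
rewrite !pair_occE big_ord_recr/= subnn big_ord0 addr0.
have -> : \sum_(k < s.+1) \sum_(l < s.+1 - k) (-1) ^+ (k + l) * (A k * A l) =
   \sum_(k < s.+1) \sum_(l < s - k) (-1) ^+ (k + l) * (A k * A l) + (-1) ^+ s * c s.
  rewrite /conv mulr_sumr -big_split; apply: eq_bigr => k _ /=.
  have ks : (k <= s)%N by rewrite -ltnS.
  by rewrite subSn// big_ord_recr/= subnKC.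
rewrite exprS; ring.
Qed.

Lemma occ_run0E : A 0 = 1 - q.
Proof. by rewrite -(one_sub_occ_run0 htau t01); ring. Qed.

Lemma conv0 : c 0 = A 0 * A 0.
Proof. by rewrite /conv big_ord1. Qed.

(** With s = 0 in [valley_split] and [valley_ends], the valley on two sites has
    probability A 0 ^ 2 / 2, and [valley_start] leads back to one site. *)
Lemma valley00 : valley 0 0 = (1 - q ^+ 2) / 2.
Proof.
have := valley_split htau t01 (leqnn 0).
rewrite (valley_ends htau) subnn occ_run0E => h.
have := valley_start htau t01 0; rewrite occ_run0E; lra.
Qed.

Lemma pair_occ0 : Q 0 = (1 - q ^+ 2) / 2.
Proof.
by rewrite pair_occE big_ord1 big_ord0 add0r mul1r valleys0 valley00.
Qed.

Lemma pair_occ_step s : Q s.+1 - Q s =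
  (-1) ^+ s.+1 / 2 * (1 - q ^+ 2 * series (exp_coeff (2 * t)) s.+1).
Proof.
have AE' : A = fun k => 1 - q * series (exp_coeff t) k.+1.
  by apply/funext => k; exact: occ_runE.
(* The case s = 0 is separate since there is no convolution of index
   s - 1. *)
suff H : c s - valleys s - valleys s.+1 =
    - (1 - q ^+ 2 * series (exp_coeff (2 * t)) s.+1) / 2.
  by rewrite pair_occS H [(-1) ^+ s.+1]exprS; ring.
have vS := valleysS s; have vst := valley_start htau t01 s.
case: s => [|s] in vS vst *.
  move: vS; rewrite valleys0 conv0 series_exp1 => vS.
  have := occ_run0E; have := valley00; move: vst => /[swap] v00 /[swap] A0.
  rewrite A0 in vS *; lra.
have vS' := valleysS s.
have step := conv_tail_step t q s; rewrite -AE' in step.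
have tail := conv_exp_tail t q s.+1; rewrite -AE' in tail.
rewrite tail in step.
have As : A s.+1 = 1 - q * series (exp_coeff t) s.+2 by rewrite AE'.
lra.
Qed.

End ClosedForm.

(** * The series *)
Section Series.
Variable R : realType.
Implicit Types x : R.

(** The terms of index s + 1, s + 3, ... of the exponential series are half
    of the sum of the tails at x and at - x, the second one with the sign
    (-1)^(s+1). *)
Lemma limn_parity_series x s :
  limn (series (fun n : nat => x ^+ (2 * n + s + 1) / ((2 * n + s + 1)`!)%:R)) =
  ((expR x - series (exp_coeff x) s.+1) +
   (-1) ^+ s.+1 * (expR (- x) - series (exp_coeff (- x)) s.+1)) / 2.
Proof.
apply/cvg_lim => //.
pose u N := ((series (exp_coeff x) (N.*2 + s.+1)%N - series (exp_coeff x) s.+1) +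
   (-1) ^+ s.+1 * (series (exp_coeff (- x)) (N.*2 + s.+1)%N - series (exp_coeff (- x)) s.+1)) / 2.
rewrite (_ : series _ = u).
  have sub y : series (exp_coeff y) (N.*2 + s.+1)%N @[N --> \oo] --> expR y.
    have h : (N.*2 + s.+1)%N @[N --> \oo] --> \oo.
      apply/cvgnyPge => m; near=> N.
      have : (m <= N)%N by near: N; exact: nbhs_infty_ge.
      by lia.
    exact: (cvg_comp _ _ h (is_cvg_series_exp_coeff y)).
  apply: cvgMr_tmp; apply: cvgD; first by apply: cvgB; [exact: sub|exact: cvg_cst].
  by apply: cvgMl_tmp; apply: cvgB; [exact: sub|exact: cvg_cst].
apply/funext => N; elim: N => [|N IH].
  by rewrite /u (_ : 0.*2 + s.+1 = s.+1)%N// !subrr mulr0 addr0 mul0r /series/= big_geq.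
have -> : series (fun n : nat => x ^+ (2 * n + s + 1) / ((2 * n + s + 1)`!)%:R) N.+1 =
  series (fun n : nat => x ^+ (2 * n + s + 1) / ((2 * n + s + 1)`!)%:R) N +
    exp_coeff x (N.*2 + s.+1)%N.
  rewrite /series/= big_nat_recr//=; congr (_ + _); rewrite /exp_coeff/=.
  by have -> : (2 * N + s + 1 = N.*2 + s.+1)%N by lia.
rewrite IH /u doubleS !addSn !addnS !series_expS.
rewrite /exp_coeff/= ![(- x) ^+ _]exprNn [(-1) ^+ _.+2]exprS.
(* Signs: the term of index 2 N + s + 1 survives, and the next one cancels. *)
have : (-1) ^+ s.+1 * (-1) ^+ (N.*2 + s).+1 = 1 :> R.
  rewrite -exprD (_ : (s.+1 + (N.*2 + s).+1 = 2 * (N + s.+1))%N); last by lia.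
  by rewrite exprM sqrrN expr1n expr1n.
move: ((-1) ^+ s.+1) ((-1) ^+ (N.*2 + s).+1) => sg sg' sg1.
rewrite -![_ * x ^+ _ / _]mulrA; set p := x ^+ (N.*2 + s).+1 / _; set r := x ^+ (N.*2 + s).+2 / _.
have ep : sg * sg' * p = p by rewrite sg1 mul1r.
have er : sg * sg' * r = r by rewrite sg1 mul1r.
lra.
Unshelve. all: by end_near. Qed.

End Series.

(** * The adsorption rules in a generic configuration *)
Section Rsa.
Variables (R : realType) (T : int -> R).
Hypothesis gT : generic T.

Definition run_state (s : int) (t : R) := [&& T s <= t, le_even T s & re_even T s].

Lemma generic_ltNl s : ~~ (T (s - 1) < T s) = (T s < T (s - 1)).
Proof. by have := @generic_ltN _ T (s - 1) gT; rewrite subrK. Qed.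

Lemma run_state_left s : run_state (s - 1) (T s) = (T (s - 1) < T s) && le_even T (s - 1).
Proof.
rewrite /run_state; have [lt|] := boolP (T (s - 1) < T s).
  rewrite (ltW lt)/= (re_evenE (s - 1))// subrK.
  by rewrite ltNge (ltW lt) andbT.
by rewrite generic_ltNl leNgt => ->.
Qed.

Lemma run_state_right s : run_state (s + 1) (T s) = (T (s + 1) < T s) && re_even T (s + 1).
Proof.
rewrite /run_state; have [lt|nlt] := boolP (T (s + 1) < T s).
  rewrite (ltW lt)/= (le_evenE (s + 1))// addrK.
  by rewrite [T s < _]ltNge (ltW lt).
by move: nlt; rewrite -generic_ltN// negbK leNgt => ->.
Qed.

Lemma run_state_rules : rsa_rules T run_state.
Proof.
move=> s t _; rewrite run_state_left run_state_right.
by rewrite /run_state [le_even T s]le_evenE// [re_even T s]re_evenE.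
Qed.

Section Unique.
Variable w : int -> R -> bool.
Hypothesis hw : rsa_rules T w.

(** At time T s the site s is still vacant for its neighbour s - 1, which
    therefore depends on s - 2 only. Induction on the length of the left run
    of s. *)
Lemma rules_left s : w (s - 1) (T s) = (T (s - 1) < T s) && le_even T (s - 1).
Proof.
have /and5P[_ _ _ /asboolP[n hn] _] := genericP s gT.
elim: n s hn => [|n IH] s; first by rewrite run_ge0.
rewrite run_rayLS hw ?generic01//.
case: (boolP (T (s - 1) < T s)) => [lt /= /IH h|]; last first.
  by rewrite generic_ltNl leNgt => ->.
rewrite (ltW lt) h (le_evenE (s - 1))// subrK hw ?generic01//.
by rewrite [T s <= _]leNgt lt /= andbT.
Qed.

Lemma rules_right s : w (s + 1) (T s) = (T (s + 1) < T s) && re_even T (s + 1).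
Proof.
have /and5P[_ _ _ _ /asboolP[n hn]] := genericP s gT.
elim: n s hn => [|n IH] s; first by rewrite run_ge0.
rewrite run_rayRS hw ?generic01//.
case: (boolP (T (s + 1) < T s)) => [lt /= /IH h|]; last first.
  by rewrite -generic_ltN// negbK leNgt => ->.
rewrite (ltW lt) h (re_evenE (s + 1))// addrK hw ?generic01//.
by rewrite [T s <= _]leNgt lt.
Qed.

Lemma rules_run_state s t : 0 <= t <= 1 -> w s t = run_state s t.
Proof.
move=> t01; rewrite hw// rules_left rules_right /run_state.
by rewrite [le_even T s]le_evenE// [re_even T s]re_evenE.
Qed.

End Unique.

Lemma rsaE s t : 0 <= t <= 1 -> rsa T s t = run_state s t.
Proof.
move=> t01; apply: rules_run_state => //.
exact: (xgetPex _ (ex_intro _ run_state run_state_rules)).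
Qed.

End Rsa.

(** * Expectations *)
Section Expectation.
Context d (Omega : measurableType d) (R : realType) (P : probability Omega R).
Local Open Scope ereal_scope.

(** The integral of a nonnegative function is a supremum over the simple
    functions below it, hence monotone for arbitrary functions. *)
Lemma le_integral_ge0 (f g : Omega -> \bar R) :
  (forall w, 0 <= f w) -> (forall w, f w <= g w) ->
  \int[P]_w f w <= \int[P]_w g w.
Proof.
move=> f0 fg; rewrite !ge0_integralTE//; last by move=> w; exact: le_trans (fg w).
by apply: le_ereal_sup => _ [h /= hf <-]; exists h => // w; exact: le_trans (fg w).
Qed.

(** X lies between the indicators of B `&` G and of B `|` ~` G, which have
    the same measure. *)
Lemma expectation_ae_indicator (G B : set Omega) (X : Omega -> R) :
    measurable G -> measurable B -> P G = 1 ->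
    (forall w, 0 <= X w <= 1)%R -> {in G, forall w, X w = \1_B w} ->
  'E_P[X] = P B.
Proof.
move=> mG mB G1 X01 XB.
have PGC : P (~` G) = 0 by rewrite probability_setC// G1 subee.
rewrite unlock; apply/eqP; rewrite eq_le; apply/andP; split.
  apply: (@le_trans _ _ (\int[P]_w (\1_(B `|` ~` G) w)%:E)).
    apply: le_integral_ge0 => w; rewrite lee_fin; first by case/andP: (X01 w).
    have [wG|nG] := pselect (G w).
      rewrite XB ?inE// !indicE; case: (boolP (w \in B)) => //.
      by rewrite inE => Bw; rewrite mem_set//; left.
    by rewrite indicE mem_set; [case/andP: (X01 w)|right].
  rewrite integral_indic//; last by apply: measurableU => //; exact: measurableC.
  rewrite setIT (le_trans (measureU2 _ _ _))//; first exact: measurableC.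
  by rewrite [X in _ + X](_ : _ = 0)// adde0.
apply: (@le_trans _ _ (\int[P]_w (\1_(B `&` G) w)%:E)).
  rewrite integral_indic ?setIT//; last exact: measurableI.
  rewrite -[leLHS](_ : P (B `&` G) + P (B `&` ~` G) = _).
    rewrite [X in _ + X](_ : _ = 0) ?adde0//.
    apply/eqP; rewrite eq_le measure_ge0 andbT -PGC le_measure ?inE//.
    - by apply: measurableI => //; exact: measurableC.
    - exact: measurableC.
  rewrite -measureU; last 3 first.
  - exact: measurableI.
  - by apply: measurableI => //; exact: measurableC.
  - by rewrite setIACA setICr setI0.
  by rewrite -setIUr setUCr setIT.
apply: le_integral_ge0 => w; rewrite lee_fin; first by rewrite indicE.
have [wG|nG] := pselect (G w).
  rewrite XB ?inE// !indicE; case: (boolP (w \in B `&` G)) => //.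
  by rewrite inE => -[Bw _]; rewrite mem_set.
by rewrite indicE memNset; [case/andP: (X01 w)|move=> [_]].
Qed.

End Expectation.

(** * The pair correlation *)
Section Main.
Context d (Omega : measurableType d) (R : realType) (P : probability Omega R).
Variable tau : int -> {RV P >-> R}.
Hypothesis htau : iid_uniform01 tau.
Variable t : R.
Hypothesis t01 : 0 <= t <= 1.
Local Notation Q := (pair_occ tau t).

Lemma event_state i : is_event (fun T : int -> R => run_state T i t).
Proof.
rewrite (_ : (fun T : int -> R => _) =
  fun T => (T i <= t) && (le_even T i && re_even T i)) //.
by event.
Qed.

Lemma expectation_event (X : Omega -> R) phi : is_event phi ->
    (forall w, 0 <= X w <= 1) ->
    (forall w, generic (fun i => tau i w) -> X w = (phi (fun i => tau i w))%:R) ->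
  ('E_P[X] = (prob tau phi)%:E)%E.
Proof.
move=> mphi X01 h; rewrite -probE//.
apply: (@expectation_ae_indicator _ _ _ _ [set w | generic (fun i => tau i w)]) => //.
- exact: (@measurable_event _ _ _ P _ tau _ (@event_generic R)).
- exact: (@measurable_event _ _ _ P _ tau _ mphi).
- by have := probE tau (@event_generic R); rewrite (prob_generic htau) => ->.
move=> w; rewrite inE => gw; rewrite h// indicE; congr (nat_of_bool _)%:R.
by apply/idP/idP => [p|]; [rewrite mem_set|rewrite inE].
Qed.

Lemma expectation_occ i : ('E_P[occ tau i t] = (Q 0)%:E)%E.
Proof.
rewrite (expectation_event (phi := fun T => run_state T i t)); first last.
- by move=> w gw; rewrite /occ rsaE.
- by move=> w; rewrite /occ; case: (rsa _ _ _); rewrite ?ler01 ?lexx.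
- exact: event_state.
congr (_%:E); rewrite -(prob_shift htau (- i)); last exact: event_state.
congr prob; apply/funext => T.
rewrite /run_state /le_even /re_even rayL_shift rayR_shift subrr.
rewrite /occL /occR /le_even /re_even.
by case: (T 0 <= t) => //=; case: even_run => //=; case: even_run.
Qed.

Lemma expectation_occ_occ (s : nat) :
  ('E_P[(occ tau 0 t \* occ tau s%:Z t)%R] = (Q s)%:E)%E.
Proof.
rewrite (expectation_event (phi := fun T => run_state T 0 t && run_state T s%:Z t)); first last.
- by move=> w gw; rewrite /occ/= !rsaE//; case: run_state; case: run_state; rewrite ?mulr1 ?mulr0.
- move=> w; rewrite /occ/=; case: (rsa _ _ _); case: (rsa _ _ _);
    by rewrite ?mulr1 ?mulr0 ?ler01 ?lexx.
- by apply: event_and; exact: event_state.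
congr (prob _ _)%:E; apply/funext => T.
rewrite /run_state /occL /occR.
case: (T 0 <= t) => //=; case: (le_even T 0) => //=; case: (re_even T 0) => //=.
by case: (T s%:Z <= t) => //=; exact: andbC.
Qed.

(** Induction on s; the increments are those of [pair_occ_step] and of
    [limn_parity_series]. *)
Lemma correlation_closed_form (s : nat) : Q s - Q 0 ^+ 2 =
  - (1 / 2) * expR (- 2 * t) *
     limn (series (fun n : nat =>
       (- 2 * t) ^+ (2 * n + s + 1) / ((2 * n + s + 1)`!)%:R)).
Proof.
rewrite limn_parity_series.
have -> : - (- 2 * t) = 2 * t by ring.
have q2 : expR (- t) ^+ 2 = expR (- 2 * t).
  by rewrite -expRM_natl; congr expR; ring.
have qE : expR (- 2 * t) * expR (2 * t) = 1.
  by rewrite -expRD -expR0; congr expR; ring.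
elim: s => [|s IH].
  rewrite !series_exp1 (pair_occ0 htau t01) q2 expr1.
  move: qE; set q := expR (- 2 * t); set E := expR (2 * t) => qE.
  have -> : - (1 / 2) * q * ((q - 1 + -1 * (E - 1)) / 2) = - (q * q - q * E) / 4 by field.
  by rewrite qE; field.
have -> : Q s.+1 - Q 0 ^+ 2 = (Q s.+1 - Q s) + (Q s - Q 0 ^+ 2) by ring.
rewrite IH (pair_occ_step htau t01) q2 !series_expS.
have -> : exp_coeff (- 2 * t) s.+1 = (-1) ^+ s.+1 * exp_coeff (2 * t) s.+1.
  by rewrite /exp_coeff/= mulNr [in LHS]exprNn mulrA.
rewrite ![(-1) ^+ s.+2]exprS.
move: qE; set q := expR (- 2 * t); set E := expR (2 * t).
set e := series (exp_coeff (2 * t)) s.+1; set e' := series _ s.+1.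
set y := exp_coeff _ _; set sg := _ ^+ s.+1 => qE.
have qE' : sg * (q * E) = sg by rewrite qE mulr1.
lra.
Qed.

End Main.

Theorem theorem2 (d : measure_display) (Omega : measurableType d)
    (R : realType) (P : probability Omega R) (tau : int -> {RV P >-> R})
    (htau : iid_uniform01 tau) (t : R) (ht : 0 <= t <= 1) (s : nat) :
  pair_correlation tau 0 s%:Z t =
  (- (1 / 2) * expR (- 2 * t) *
     limn (series (fun n : nat =>
       (- 2 * t) ^+ (2 * n + s + 1) / ((2 * n + s + 1)`!)%:R)))%:E.
Proof.
rewrite /pair_correlation (expectation_occ_occ htau ht) !(expectation_occ htau ht).
by rewrite -EFinM -EFinB -expr2 (correlation_closed_form htau ht).
Qed.
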